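(* There exist universal constants $C_0,C_1,C_2>0$ such that for all $n\ge3$ and all $p$ with $$\frac12\ge p\ge\frac{C_0\log n}{n\log\log n},$$ the operator norm $Z=\|A\|_{\mathrm{op}}$ of the adjacency matrix $A$ of an Erdős–Rényi graph $\mathbb G(n,p)$ satisfies $$\mathbb P(|Z-\mathbb EZ|\ge t)\le\exp\Big\{1-\frac{t^{2}}{C_1\sigma^{2}}\Big\},\qquad\forall\,0\le t\le C_2\,\sigma\sqrt{np}\,\min\Big\{1,\sqrt{\frac{\log(np)}{\log(1/p)}}\Big\},$$ where $$\sigma=\sqrt p\Big(1+\frac{(\log n)^{2}}{(np)^{2}}\Big).$$
   Context: $A$ is the random symmetric $n\times n$ matrix with zero diagonal whose entries $(A_{ij})_{i<j}$ are i.i.d. Bernoulli$(p)$. A constant is universal if it does not depend on $n$ or $p$. *)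

(* Defs.v *)
From HB Require Import structures.
From mathcomp Require Export all_boot all_order all_algebra.
From mathcomp Require Export all_classical all_reals all_analysis.

Set Implicit Arguments.
Unset Strict Implicit.
Unset Printing Implicit Defensive.

Import Order.TTheory GRing.Theory Num.Theory.
Import numFieldNormedType.Exports.

Local Open Scope classical_set_scope.
Local Open Scope ring_scope.

(* The canonical norm of the library on matrices is the sup norm, so the
   Euclidean norm and the operator norm it induces are defined here. *)
Definition euclidean_norm (R : realType) (n : nat) (x : 'cV[R]_n) : R :=
  Num.sqrt (\sum_(i < n) x i 0 ^+ 2).

Definition opnorm (R : realType) (m n : nat) (M : 'M[R]_(m, n)) : R :=
  sup [set euclidean_norm (M *m x) | x in [set x | euclidean_norm x <= 1]].

(* Only the variables X i with D i are considered. *)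
Definition mutually_independent (d : measure_display) (T : measurableType d)
    (R : realType) (P : probability T R) (I : finType) (D : set I)
    (X : I -> T -> R) : Prop :=
  forall (J : {set I}) (B : I -> set R),
    (forall i, i \in J -> D i) ->
    (forall i, measurable (B i)) ->
    P (\bigcap_(i in [set` J]) (X i @^-1` B i)) =
    (\prod_(i in J) P (X i @^-1` B i))%E.

(* The library's Bernoulli law lives on bool: it is pushed forward to R along
   true |-> 1, false |-> 0. *)
Definition bernoulli_distributed (d : measure_display) (T : measurableType d)
    (R : realType) (P : probability T R) (p : R) (X : T -> R) : Prop :=
  forall B : set R, measurable B ->
    P (X @^-1` B) = bernoulli_prob p [set b : bool | B b%:R].

Record erdos_renyi_adjacency (d : measure_display) (T : measurableType d)
    (R : realType) (P : probability T R) (n : nat) (p : R)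
    (A : T -> 'M[R]_n) : Prop := {
  er_symmetric : forall w, (A w)^T = A w ;
  er_diagonal : forall w i, A w i i = 0 ;
  er_measurable : forall i j : 'I_n, (i < j)%N ->
    measurable_fun [set: T] (fun w => A w i j) ;
  er_bernoulli : forall i j : 'I_n, (i < j)%N ->
    bernoulli_distributed P p (fun w => A w i j) ;
  er_independent :
    mutually_independent P [set e : 'I_n * 'I_n | (e.1 < e.2)%N]
      (fun e w => A w e.1 e.2)
}.

Definition er_sigma (R : realType) (n : nat) (p : R) : R :=
  Num.sqrt p * (1 + ln n%:R ^+ 2 / (n%:R * p) ^+ 2).

(* Main.v *)
Require Import Defs.
From mathcomp Require Import ring lra measurable_realfun.

(** The random graph is encoded as the random set [G] of its edges, and [Z] is
    the function [graph_norm] of [G].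

    A convex-distance inequality of Talagrand type is used in functional form
    ([infconv_exp]): for every function [h] on the cube, the product of the
    expectations of [exp (Q h)] and [exp (- h)] is at most 1, where [Q h] is an
    infimum convolution of [h] with a quadratic cost.  If [h] decreases by at
    most the sum of weights [al e] when the edges [e] are changed, then [Q h] is
    at least [h] minus twice the sum of the squares of the weights
    ([infconv_certificate]).  For [h = th * Z] this controls the Laplace
    transform of [Z - E Z] in both directions, with no median
    ([certified_concentration]).

    The weights come from a nonnegative unit Perron vector [v] of the adjacency
    matrix: deleting an edge [e] decreases [Z] by at most twice the product of
    the two entries of [v] at the ends of [e], and adding an edge does not
    decrease it.  The variance proxy is therefore the influence, which is 4
    times the sum over the edges of the squared products.  It has to be of order
    [sigma ^ 2], and this is a statement about the delocalization of [v]: by the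
    degree bound it is enough to bound the sum of the fourth powers of [v].

    Let [x = n p], [M = 1 + log n / x], [T = x M = x + log n].  The fourth
    powers are bounded deterministically ([influence_bound]) from four
    properties of the graph: all degrees are O(T); few vertices have degree
    above [40 x]; the number of edges is at least a constant fraction of its
    mean, so that [Z >= x / 8]; and every set of at most [s0] vertices, where
    [s0] is of order [n / M ^ 3], spans few edges.  Let [u = (v - a)_+] with
    [a ^ 2 = 1 / s0].  The support of [u] has at most [s0] vertices, and testing
    the eigenvalue equation against [u ^ 3] gives
      [Z * sum u ^ 4 <= a * sum deg * u ^ 3 + <u ^ 3, A u>].
    By a layer-cake argument ([sum_min_edges]) the sparsity of small sets bounds
    the last term by [Z / 2 * sum u ^ 4] ([quartic_form_le]), and the first one
    is absorbed by Young's inequality.  The influence is then O([p M ^ 4]),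
    which is O([sigma ^ 2]).

    The four properties fail with probability at most [exp (- 2 T)]
    ([bad_graph_tail]), by exponential Markov inequalities and union bounds over
    vertex sets.  Everything asymptotic is concentrated in the single condition
    [K * M ^ 9 <= x], which the lower bound on [p] guarantees for all large [n]
    ([density_dominates_sparsity]).  For the remaining [n] the allowed
    deviations are so small that the right-hand side is at least 1. *)

Import Order.TTheory GRing.Theory Num.Theory.
Import numFieldNormedType.Exports.
Local Open Scope ring_scope.
Set Implicit Arguments.
Unset Strict Implicit.
Unset Printing Implicit Defensive.

(** * An infimum convolution on two points *)

Section InfConv2.
Variable R : realType.
Implicit Types a b c g k : R.

(** The minimum over [k] in [0, 1] of [(1 - k) * a + k * b + k ^ 2 / 8]: with
    probability [k] one moves to the other point, at a quadratic cost.  The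
    minimum is attained at [k = min 1 (4 * (a - b))] if [b < a]. *)
Definition infconv2 a b : R :=
  if a <= b then a
  else if a - b <= 4^-1 then a - 2 * (a - b) ^+ 2
  else b + 8^-1.

Lemma infconv2_le a b k : 0 <= k -> k <= 1 ->
  infconv2 a b <= (1 - k) * a + k * b + k ^+ 2 / 8.
Proof.
move=> k0 k1; rewrite /infconv2; case: (leP a b) => [ab|ba].
  have h : 0 <= k * (b - a) by rewrite mulr_ge0// subr_ge0.
  have := sqr_ge0 k; nra.
have := sqr_ge0 (k - 4 * (a - b)); case: (leP (a - b) _) => h h2; first nra.
have : 0 <= (1 - k) * (a - b - 4^-1) by rewrite mulr_ge0// subr_ge0// ltW.
have := sqr_ge0 (1 - k); nra.
Qed.

Lemma infconv2_ge a b c (al : R) : c <= a -> c - al <= b ->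
  c - 2 * al ^+ 2 <= infconv2 a b.
Proof.
move=> ca cb; rewrite /infconv2; have := sqr_ge0 al; case: (leP a b) => [ab|ba]; first by nra.
have h1 : 0 <= a - c by rewrite subr_ge0.
case: (leP (a - b) _) => h s.
  have h2 : 0 <= (1 - 4 * (a - b)) * (a - c) by rewrite mulr_ge0//; lra.
  have [h3|h3] := leP (a - b) (a - c); first by nra.
  have h5 : 0 <= (al - (c - b)) * ((c - b) + al).
    by rewrite mulr_ge0//; lra.
  have := sqr_ge0 (a - c); nra.
have := sqr_ge0 (4 * al - 1); nra.
Qed.

Lemma expR_le_inv (x : R) : x < 1 -> expR x <= (1 - x)^-1.
Proof.
move=> x1; rewrite -(opprK x) expRN opprK lef_pV2 ?posrE ?expR_gt0 ?subr_gt0//.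
exact: expR_ge1Dx.
Qed.

Lemma expRN_le_inv (x : R) : -1 < x -> expR (- x) <= (1 + x)^-1.
Proof. by move=> x1; have := @expR_le_inv (- x); rewrite opprK; apply; lra. Qed.

(** The scalar inequality behind the two-point case.  For small [g] the
    optimal choice [k = 4 * g] gives the exponent [g - 2 * g ^ 2], and the
    inequality is a second-order comparison at 0; for larger [g] the choice
    [k = 1] leaves only numbers to compare. *)
Lemma talagrand_exponent g : 0 <= g ->
  exists2 k, 0 <= k <= 1 & expR ((1 - k) * g + k ^+ 2 / 8) <= 2 - expR (- g).
Proof.
move=> g0; have [g4|g4] := leP g 4^-1.
  exists (4 * g); first by lra.
  have -> : (1 - 4 * g) * g + (4 * g) ^+ 2 / 8 = g - 2 * g ^+ 2 by field.
  set x := g - _.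
  have x0 : 0 <= x by rewrite /x; nra.
  have x8 : x <= 8^-1 by rewrite /x; have := sqr_ge0 (g - 4^-1); nra.
  have e1 : expR x <= 1 + x + x ^+ 2.
    have -> : x = 2%:R * (x / 2) by field.
    rewrite expRM_natl; have h : expR (x / 2) <= (1 - x / 2)^-1.
      by apply: expR_le_inv; lra.
    have h2 : expR (x / 2) ^+ 2 <= (1 - x / 2)^-1 ^+ 2.
      by rewrite lerXn2r// nnegrE ?expR_ge0// invr_ge0; lra.
    apply: (le_trans h2); rewrite exprVn -div1r ler_pdivrMr; last by apply: exprn_gt0; lra.
    have : 0 <= x ^+ 2 * (1 - 3 * x + x ^+2) by rewrite mulr_ge0 ?sqr_ge0//; nra.
    nra.
  have e2 : expR (- g) <= 1 - g + (3 / 4) * g ^+ 2.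
    have -> : - g = 2%:R * - (g / 2) by field.
    rewrite expRM_natl; have h : expR (- (g / 2)) <= (1 + g / 2)^-1.
      by apply: expRN_le_inv; lra.
    have h2 : expR (- (g / 2)) ^+ 2 <= (1 + g / 2)^-1 ^+ 2.
      by rewrite lerXn2r// nnegrE ?expR_ge0// invr_ge0; lra.
    apply: (le_trans h2); rewrite exprVn -div1r ler_pdivrMr; last by apply: exprn_gt0; lra.
    have := exprn_ge0 3 g0; have := exprn_ge0 4 g0; nra.
  suff : x ^+ 2 <= g ^+ 2 by rewrite /x in e1 *; nra.
  by rewrite lerXn2r// /x; nra.
exists 1; first by lra.
have -> : (1 - 1) * g + 1 ^+ 2 / 8 = 8^-1 by field.
have h1 : expR (8^-1) <= 8 / 7 :> R.
  by rewrite (_ : 8 / 7 = (1 - 8^-1)^-1); [apply: expR_le_inv; lra|field].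
have h2 : expR (- g) <= expR (- 4^-1) by rewrite ler_expR; lra.
have h3 : expR (- 4^-1) <= 4 / 5 :> R.
  by rewrite (_ : 4 / 5 = (1 + 4^-1)^-1); [apply: expRN_le_inv; lra|field].
lra.
Qed.

End InfConv2.
Arguments infconv2 {R} a b.
Arguments infconv2_le {R} a b k.
Arguments infconv2_ge {R} a b c al.

(** * The infimum-convolution inequality on the discrete cube *)

Section Cube.
Variables (R : realType) (T : finType).
Implicit Types (p : R) (s : seq T) (f g h : {set T} -> R) (x y G F : {set T}).

Lemma set0_subseq s : (finset.set0 : {set T}) \subset s.
Proof. by apply/fintype.subsetP => z; rewrite finset.in_set0. Qed.

Lemma subset_cons e s G : G \subset s -> G \subset e :: s.
Proof. by move=> /fintype.subsetP Gs; apply/fintype.subsetP => z /Gs; rewrite inE orbC => ->. Qed.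

Lemma subsetU1_cons e s G : G \subset s -> e |: G \subset e :: s.
Proof.
move=> /fintype.subsetP Gs; apply/fintype.subsetP => z.
by rewrite finset.in_setU1 inE => /orP[->//|/Gs ->]; rewrite orbT.
Qed.

Lemma subset_notin e s G : e \notin s -> G \subset s -> e \notin G.
Proof. by move=> es /fintype.subsetP Gs; apply/negP => /Gs; rewrite (negPf es). Qed.

(** Expectation of [f G] when [G] contains each element of [s] independently
    with probability [p].  The recursion on [s] makes tensorization arguments
    plain inductions. *)
Fixpoint bexp p s f : R :=
  if s is e :: s' then
    (1 - p) * bexp p s' f + p * bexp p s' (fun G => f (e |: G))
  else f finset.set0.

Lemma bexpD p s f g : bexp p s (fun G => f G + g G) = bexp p s f + bexp p s g.
Proof. by elim: s f g => //= e s IH f g; rewrite !IH; ring. Qed.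

Lemma bexpZ p s c f : bexp p s (fun G => c * f G) = c * bexp p s f.
Proof. by elim: s f => //= e s IH f; rewrite !IH; ring. Qed.

Lemma bexp_cst p s c : bexp p s (fun=> c) = c.
Proof. by elim: s => //= e s ->; ring. Qed.

Lemma bexp_sum p s (I : Type) (r : seq I) (Q : pred I) (F : I -> {set T} -> R) :
  bexp p s (fun G => \sum_(i <- r | Q i) F i G) =
  \sum_(i <- r | Q i) bexp p s (F i).
Proof.
elim: r => [|i r IH].
  by under eq_fun do rewrite big_nil; rewrite big_nil bexp_cst.
under eq_fun do rewrite big_cons; rewrite big_cons.
by case: (Q i) => //; rewrite bexpD IH.
Qed.

Lemma ler_bexp p s f g : 0 <= p <= 1 ->
  (forall G, G \subset s -> f G <= g G) -> bexp p s f <= bexp p s g.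
Proof.
move=> p01; elim: s f g => [|e s IH] f g fg /=; first by apply: fg; exact: set0_subseq.
apply: lerD; apply: ler_wpM2l; [lra| |lra|]; apply: IH => G Gs; apply: fg.
  exact: subset_cons.
exact: subsetU1_cons.
Qed.

Lemma bexp_ge0 p s f : 0 <= p <= 1 ->
  (forall G, G \subset s -> 0 <= f G) -> 0 <= bexp p s f.
Proof. by move=> p01 f0; rewrite -(bexp_cst p s 0); exact: ler_bexp. Qed.

Lemma bexp_gt0 p s f : 0 <= p <= 1 -> (forall G, 0 < f G) -> 0 < bexp p s f.
Proof.
move=> /andP[p0 p1]; elim: s f => //= e s IH f f0.
have h1 := IH f f0; have h2 := IH (fun G => f (e |: G)) (fun G => f0 _).
have := mulr_ge0 p0 (ltW h2); have : 0 <= (1 - p) * bexp p s f.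
  by rewrite mulr_ge0 ?subr_ge0// ltW.
move=> h3 h4; have [p2|p2] := ltP p 2^-1.
  by rewrite ltr_pwDl// mulr_gt0// subr_gt0; lra.
by rewrite ltr_wpDl// mulr_gt0//; lra.
Qed.

Lemma eq_bexp p s f g :
  (forall G, G \subset s -> f G = g G) -> bexp p s f = bexp p s g.
Proof.
elim: s f g => [|e s IH] f g fg /=; first by apply: fg; exact: set0_subseq.
congr (_ * _ + _ * _); apply: IH => G Gs; apply: fg.
  exact: subset_cons.
exact: subsetU1_cons.
Qed.

(** Iterated infimum convolution, coordinate by coordinate: for each element
    of [s] one may switch its membership in [x] at the cost of [infconv2]. *)
Fixpoint infconv s h x : R :=
  if s is e :: s' then
    let q0 := infconv s' h x in
    let q1 := infconv s' (fun G => h (e |: G)) x in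
    if e \in x then infconv2 q1 q0 else infconv2 q0 q1
  else h finset.set0.

Lemma infconvU1 s h e x : e \notin s -> infconv s h (e |: x) = infconv s h x.
Proof.
elim: s h => //= a s IH h; rewrite inE negb_or => /andP[ea es].
by rewrite !IH// !inE eq_sym (negPf ea).
Qed.

(** Each coordinate loses at most twice the square of its weight, since
    [- k * al + k ^ 2 / 8 >= - 2 * al ^ 2] for all [k]. *)
Lemma infconv_certificate s h x (al : T -> R) c :
  uniq s ->
  (forall y, y \subset s ->
     c - \sum_(e <- s | (e \in x) != (e \in y)) al e <= h y) ->
  c - 2 * \sum_(e <- s) al e ^+ 2 <= infconv s h x.
Proof.
elim: s h c => [|e s IH] h c.
  by move=> _ /(_ finset.set0); rewrite !big_nil mulr0 subr0 => /= -> //; exact: set0_subseq.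
rewrite /= => /andP[es us] H; rewrite big_cons.
have ss := @subset_cons e s; have ss1 := @subsetU1_cons e s.
have enG G := @subset_notin e s G es.
have sE y : \sum_(i <- s | (i \in x) != (i \in e |: y)) al i
   = \sum_(i <- s | (i \in x) != (i \in y)) al i.
  rewrite big_seq_cond [RHS]big_seq_cond; apply: eq_bigl => i.
  case: (boolP (i \in s)) => //= si.
  rewrite finset.in_setU1 (_ : (i == e) = false)//.
  by apply: contraNF es => /eqP <-.
case: ifPn => ex.
- have h1 : c - 2 * \sum_(e <- s) al e ^+ 2 <= infconv s (fun G => h (e |: G)) x.
    apply: IH => // y ys; have := H _ (ss1 _ ys).
    by rewrite big_cons !inE eqxx/= ex/= sE.
  have h2 : (c - al e) - 2 * \sum_(e <- s) al e ^+ 2 <= infconv s h x.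
    apply: IH => // y ys; have := H _ (ss _ ys).
    by rewrite big_cons (negPf (enG _ ys)) ex/= opprD addrA.
  rewrite [X in X <= _](_ : _ = (c - 2 * \sum_(e <- s) al e ^+ 2) - 2 * al e ^+ 2); last by ring.
  by apply: infconv2_ge => //; apply: le_trans h2; rewrite lerBlDr; lra.
- have h1 : c - 2 * \sum_(e <- s) al e ^+ 2 <= infconv s h x.
    apply: IH => // y ys; have := H _ (ss _ ys).
    by rewrite big_cons (negPf (enG _ ys)) (negPf ex)/=.
  have h2 : (c - al e) - 2 * \sum_(e <- s) al e ^+ 2 <= infconv s (fun G => h (e |: G)) x.
    apply: IH => // y ys; have := H _ (ss1 _ ys).
    by rewrite big_cons !inE eqxx/= (negPf ex)/= sE opprD addrA.
  rewrite [X in X <= _](_ : _ = (c - 2 * \sum_(e <- s) al e ^+ 2) - 2 * al e ^+ 2); last by ring.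
  by apply: infconv2_ge => //; apply: le_trans h2; rewrite lerBlDr; lra.
Qed.

Lemma expR_conv (a b k : R) : 0 <= k <= 1 ->
  expR ((1 - k) * a + k * b) <= (1 - k) * expR a + k * expR b.
Proof.
move=> k01; set m := (1 - k) * a + k * b.
have t c : expR m * (1 + (c - m)) <= expR c.
  have -> : expR c = expR m * expR (c - m) by rewrite -expRD; congr expR; ring.
  by rewrite ler_wpM2l ?expR_ge0// expR_ge1Dx.
have ta : (1 - k) * (expR m * (1 + (a - m))) <= (1 - k) * expR a.
  by apply: ler_wpM2l => //; lra.
have tb : k * (expR m * (1 + (b - m))) <= k * expR b by apply: ler_wpM2l => //; lra.
have : (1 - k) * (expR m * (1 + (a - m))) + k * (expR m * (1 + (b - m))) = expR m.
  by rewrite /m; ring.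
lra.
Qed.

(** Hoelder's inequality, normalized so that it is only convexity of the
    exponential after division by [expR a] and [expR b]. *)
Lemma bexp_hoelder p s f g (a b k : R) : 0 <= p <= 1 -> 0 <= k <= 1 ->
  bexp p s (fun G => expR (f G)) <= expR a ->
  bexp p s (fun G => expR (g G)) <= expR b ->
  bexp p s (fun G => expR ((1 - k) * f G + k * g G)) <= expR ((1 - k) * a + k * b).
Proof.
move=> p01 k01 fa gb; set m := (1 - k) * a + k * b.
have /ler_bexp : forall G, G \subset s -> expR ((1 - k) * f G + k * g G) <=
    expR m * ((1 - k) * expR (- a) * expR (f G) + k * expR (- b) * expR (g G)).
  move=> G _; have -> : (1 - k) * f G + k * g G = m + ((1 - k) * (f G - a) + k * (g G - b)).
    by rewrite /m; ring.
  rewrite expRD ler_wpM2l ?expR_ge0//; apply: (le_trans (expR_conv _ _ _)) => //.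
  by rewrite !expRD; lra.
move=> /(_ p p01) /le_trans; apply.
rewrite bexpZ bexpD !bexpZ -[leRHS]mulr1 ler_wpM2l ?expR_ge0//.
have ha : expR (- a) * bexp p s (fun G => expR (f G)) <= 1.
  by rewrite -(expRxMexpNx_1 a) mulrC; apply: ler_wpM2r => //; exact: expR_ge0.
have hb : expR (- b) * bexp p s (fun G => expR (g G)) <= 1.
  by rewrite -(expRxMexpNx_1 b) mulrC; apply: ler_wpM2r => //; exact: expR_ge0.
rewrite -!mulrA.
have h1 : (1 - k) * (expR (- a) * bexp p s (fun G => expR (f G))) <= (1 - k) * 1.
  by apply: ler_wpM2l => //; lra.
have h2 : k * (expR (- b) * bexp p s (fun G => expR (g G))) <= k * 1.
  by apply: ler_wpM2l => //; lra.
lra.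
Qed.

Lemma expR_exists_ln (y : R) : 0 < y -> exists a, y = expR a.
Proof. by move=> y0; exists (ln y); rewrite lnK. Qed.

(** The inequality for one coordinate: [X] and [Y] are the contributions of
    the two points, [A] and [B] the values of the function, and
    [talagrand_exponent] at [B - A] reduces the claim to
    [(1 + q) * (1 - q) <= 1] with [q = p * (1 - expR (A - B))]. *)
Lemma two_point (p A B X Y : R) : 0 <= p <= 1 -> A <= B ->
  X <= expR A ->
  (forall k, 0 <= k <= 1 -> Y <= expR ((1 - k) * B + k * A + k ^+ 2 / 8)) ->
  ((1 - p) * X + p * Y) * ((1 - p) * expR (- A) + p * expR (- B)) <= 1.
Proof.
move=> p01 AB XA YB.
have [|k k01 hk] := @talagrand_exponent R (B - A); first by rewrite subr_ge0.
rewrite opprB in hk; set r := expR (A - B) in hk.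
have hY : Y <= expR A * (2 - r).
  apply: (le_trans (YB k k01)).
  rewrite (_ : _ + _ = A + ((1 - k) * (B - A) + k ^+ 2 / 8)); last by ring.
  by rewrite expRD ler_wpM2l ?expR_ge0.
have eB : expR (- B) = expR (- A) * r by rewrite /r -expRD; congr expR; ring.
have r0 : 0 < r by rewrite expR_gt0.
have eA := expRxMexpNx_1 A; have pA := expR_gt0 A; have pNA := expR_gt0 (- A).
rewrite eB; apply: (@le_trans _ _ ((expR A * (1 + p * (1 - r))) * (expR (- A) * (1 - p * (1 - r))))).
  rewrite (_ : (1 - p) * expR (- A) + p * (expR (- A) * r) = expR (- A) * (1 - p * (1 - r))); last by ring.
  apply: ler_wpM2r.
    rewrite mulr_ge0 ?expR_ge0//; have : 0 <= p * r by rewrite mulr_ge0//; lra.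
    by lra.
  have h1 : (1 - p) * X <= (1 - p) * expR A by apply: ler_wpM2l => //; lra.
  have h2 : p * Y <= p * (expR A * (2 - r)) by apply: ler_wpM2l => //; lra.
  by lra.
rewrite mulrACA eA mul1r; have := sqr_ge0 (p * (1 - r)); lra.
Qed.

(** Induction on [s]: conditionally on the first coordinate, Hoelder's
    inequality bounds the mixture of the two slices by the mixture of their
    logarithmic Laplace transforms, for each mixing parameter, and [two_point]
    then treats the first coordinate. *)
Theorem infconv_exp p s h : 0 <= p <= 1 -> uniq s ->
  bexp p s (fun G => expR (infconv s h G)) * bexp p s (fun G => expR (- h G)) <= 1.
Proof.
move=> p01; elim: s h => [|e s IH] h /=.
  by move=> _; rewrite -expRD addrN expR0.
move=> /andP[es us].
have enG G := @subset_notin e s G es.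
set h1 := fun G => h (e |: G).
set Q0 := infconv s h; set Q1 := infconv s h1.
have E0 : bexp p s (fun G => expR (if e \in G then infconv2 (Q1 G) (Q0 G) else infconv2 (Q0 G) (Q1 G)))
   = bexp p s (fun G => expR (infconv2 (Q0 G) (Q1 G))).
  by apply: eq_bexp => G /enG/negPf ->.
have E1 : bexp p s (fun G => expR (if e \in e |: G then infconv2 (Q1 (e |: G)) (Q0 (e |: G)) else infconv2 (Q0 (e |: G)) (Q1 (e |: G))))
   = bexp p s (fun G => expR (infconv2 (Q1 G) (Q0 G))).
  by apply: eq_bexp => G _; rewrite !inE eqxx /Q1 /Q0 !infconvU1.
rewrite E0 E1.
have [A eA] : exists A, bexp p s (fun G => expR (- h G)) = expR (- A).
  have [A ->] := expR_exists_ln (bexp_gt0 s p01 (fun G => expR_gt0 (- h G))).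
  by exists (- A); rewrite opprK.
have [B eB] : exists B, bexp p s (fun G => expR (- h1 G)) = expR (- B).
  have [B ->] := expR_exists_ln (bexp_gt0 s p01 (fun G => expR_gt0 (- h1 G))).
  by exists (- B); rewrite opprK.
rewrite eA eB.
have qA : bexp p s (fun G => expR (Q0 G)) <= expR A.
  by have := IH h us; rewrite eA expRN ler_pdivrMr ?expR_gt0// mul1r.
have qB : bexp p s (fun G => expR (Q1 G)) <= expR B.
  by have := IH h1 us; rewrite eB expRN ler_pdivrMr ?expR_gt0// mul1r.
have mix f g a b k : 0 <= k <= 1 -> bexp p s (fun G => expR (f G)) <= expR a ->
   bexp p s (fun G => expR (g G)) <= expR b ->
   bexp p s (fun G => expR (infconv2 (f G) (g G))) <= expR ((1 - k) * a + k * b + k ^+ 2 / 8).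
  move=> k01 fa gb; rewrite expRD.
  apply: le_trans (ler_wpM2r (expR_ge0 _) (bexp_hoelder p01 k01 fa gb)).
  rewrite mulrC -bexpZ; apply: ler_bexp => // G _.
  by rewrite -expRD ler_expR addrC; apply: infconv2_le; lra.
have mix0 f g a b : bexp p s (fun G => expR (f G)) <= expR a ->
   bexp p s (fun G => expR (g G)) <= expR b ->
   bexp p s (fun G => expR (infconv2 (f G) (g G))) <= expR a.
  move=> fa gb; have := mix f g a b 0 _ fa gb.
  by rewrite subr0 mul1r mul0r expr0n/= mul0r !addr0; apply; lra.
case: (leP A B) => AB.
  apply: two_point => //; first exact: mix0 qA qB.
  by move=> k k01; apply: mix.
have p01' : 0 <= 1 - p <= 1 by lra.
have := @two_point (1 - p) B A _ _ p01' (ltW AB) (mix0 _ _ _ _ qB qA) (fun k k01 => mix _ _ _ _ k k01 qA qB).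
by rewrite (_ : 1 - (1 - p) = p); [rewrite [X in _ * X]addrC [X in X * _]addrC|ring].
Qed.

End Cube.

(** * Concentration of functions with certificates *)

Section Concentration.
Variables (R : realType) (T : finType) (p : R) (s : seq T).
Hypotheses (p01 : 0 <= p <= 1) (us : uniq s).
Variables (Z : {set T} -> R) (good : pred {set T}) (v N : R).
Hypotheses (v0 : 0 < v).
Hypothesis Z0 : forall G, 0 <= Z G <= N.
Hypothesis cert : forall x : {set T}, x \subset s -> good x ->
  exists2 al : T -> R, \sum_(e <- s) al e ^+ 2 <= v &
  forall y : {set T}, y \subset s ->
    Z x - \sum_(e <- s | (e \in x) != (e \in y)) al e <= Z y.

Let mean := bexp p s Z.
Let bad := bexp p s (fun G => (~~ good G)%:R).

(** [infconv_exp] for [th * Z], keeping on the left only the graphs that have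
    a certificate of small total weight. *)
Lemma laplace_good (th : R) : 0 <= th ->
  bexp p s (fun G => (good G)%:R * expR (th * Z G)) *
  bexp p s (fun G => expR (- (th * Z G))) <= expR (2 * th ^+ 2 * v).
Proof.
move=> th0; have := infconv_exp (fun G => th * Z G) p01 us.
set E2 := bexp p s (fun G => expR (- _)) => H.
have E20 : 0 < E2 by apply: bexp_gt0 => // G; exact: expR_gt0.
suff h : bexp p s (fun G => (good G)%:R * expR (th * Z G)) <=
    expR (2 * th ^+ 2 * v) * bexp p s (fun G => expR (infconv s (fun G => th * Z G) G)).
  apply: (le_trans (ler_wpM2r (ltW E20) h)).
  by rewrite -[leRHS]mulr1 -(mulrA (expR _)); apply: ler_wpM2l => //; exact: expR_ge0.
rewrite -bexpZ; apply: ler_bexp => // G Gs.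
case: (boolP (good G)) => gG; last first.
  by rewrite mul0r mulr_ge0 ?expR_ge0.
rewrite mul1r -expRD ler_expR -lerBlDl.
have [al alv alZ] := cert Gs gG.
have h : th * Z G - 2 * \sum_(e <- s) (th * al e) ^+ 2 <= infconv s (fun G => th * Z G) G.
  apply: infconv_certificate => // y ys; rewrite -mulr_sumr -mulrBr.
  by apply: ler_wpM2l => //; exact: alZ.
apply: le_trans h; apply: lerB => //; rewrite -mulrA ler_wpM2l//.
have -> : \sum_(e <- s) (th * al e) ^+ 2 = th ^+ 2 * \sum_(e <- s) (al e) ^+ 2.
  by rewrite mulr_sumr; apply: eq_bigr => e _; rewrite exprMn.
by apply: ler_wpM2l => //; exact: sqr_ge0.
Qed.

Lemma mean_ge0 : 0 <= mean.
Proof. by apply: bexp_ge0 => // G _; case/andP: (Z0 G). Qed.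

Lemma jensen_expN (th : R) : expR (- (th * mean)) <= bexp p s (fun G => expR (- (th * Z G))).
Proof.
apply: (@le_trans _ _ (bexp p s (fun G => expR (- (th * mean)) * (1 + th * mean + (- th) * Z G)))).
  by rewrite bexpZ bexpD bexp_cst bexpZ -/mean mulNr -addrA addrN addr0 mulr1.
apply: ler_bexp => // G _.
rewrite (_ : - (th * Z G) = - (th * mean) + (th * mean - th * Z G)); last by ring.
by rewrite expRD ler_wpM2l ?expR_ge0// mulNr -addrA expR_ge1Dx.
Qed.

(** By [laplace_good], since [jensen_expN] bounds the second factor from
    below. *)
Lemma upper_tail (th t : R) : 0 <= th ->
  bexp p s (fun G => (good G && (mean + t <= Z G)%R)%:R) <=
  expR (2 * th ^+ 2 * v - th * t).
Proof.
move=> th0; have H := laplace_good th0; have J := jensen_expN th.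
set E1 := bexp _ _ _ in H; set E2 := bexp _ _ _ in H J.
have E20 : 0 < E2 by apply: bexp_gt0 => // G; exact: expR_gt0.
have E10 : 0 <= E1 by apply: bexp_ge0 => // G _; rewrite mulr_ge0 ?expR_ge0.
have h : bexp p s (fun G => (good G && (mean + t <= Z G)%R)%:R) <= expR (- (th * mean) - th * t) * E1.
  rewrite -bexpZ; apply: ler_bexp => // G _.
  case: (good G) => /=; last by rewrite mul0r mulr0.
  rewrite mul1r -expRD; case: (leP (mean + t) (Z G)) => /= mZ; last exact: expR_ge0.
  rewrite -expR0 ler_expR; have := ler_wpM2l th0 mZ; lra.
apply: (le_trans h); rewrite !expRD.
have J' := ler_wpM2r E10 J; rewrite [E2 * _]mulrC in J'.
have H' := le_trans J' H.
have e0 := expR_ge0 (- (th * t)); have := ler_wpM2r e0 H'; lra.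
Qed.

(** Here the first factor of [laplace_good] has to be bounded from below.  The
    bad event costs [bad * (1 + th * N)] in Jensen's inequality, because [Z]
    may be as large as [N] there. *)
Lemma lower_tail (th t : R) : 0 <= th -> bad * (1 + th * N) <= 2^-1 ->
  bexp p s (fun G => (Z G <= mean - t)%R%:R) <=
  2 * expR (2 * th ^+ 2 * v - th * t).
Proof.
move=> th0 hbad; have H := laplace_good th0.
set E1 := bexp _ _ _ in H; set E2 := bexp _ _ _ in H.
have E20 : 0 < E2 by apply: bexp_gt0 => // G; exact: expR_gt0.
have J : 2^-1 * expR (th * mean) <= E1.
  apply: (@le_trans _ _ (bexp p s (fun G => expR (th * mean) *
     ((1 - th * mean + th * Z G) + - (1 + th * N) * (~~ good G)%:R)))).
    rewrite bexpZ !bexpD !bexp_cst !bexpZ -/mean -/bad mulrC ler_wpM2l ?expR_ge0//; lra.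
  apply: ler_bexp => // G _; case: (good G) => /=.
    rewrite mul1r mulr0 addr0.
    rewrite (_ : th * Z G = (th * mean) + (th * Z G - th * mean)); last by ring.
    rewrite expRD ler_wpM2l ?expR_ge0//; have := @expR_ge1Dx R (th * Z G - th * mean).
    lra.
  rewrite mulr1 mul0r mulr_ge0_le0 ?expR_ge0//.
  have /andP[_ ZN] := Z0 G; have := ler_wpM2l th0 ZN; have := mulr_ge0 th0 mean_ge0.
  lra.
have h : bexp p s (fun G => (Z G <= mean - t)%R%:R) <= expR (th * mean - th * t) * E2.
  rewrite -bexpZ; apply: ler_bexp => // G _.
  rewrite -expRD; case: (leP (Z G) (mean - t)) => /= mZ; last exact: expR_ge0.
  rewrite -expR0 ler_expR; have := ler_wpM2l th0 mZ; lra.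
apply: (le_trans h); rewrite !expRD.
have J' := ler_wpM2r (ltW E20) J.
have H' := le_trans J' H.
have e0 := expR_ge0 (- (th * t)); have := ler_wpM2r e0 H'; lra.
Qed.

(** The two tails at the optimal parameter [th = t / (4 * v)]. *)
Theorem certified_concentration (t : R) : 0 <= t ->
  bad * (1 + t / (4 * v) * N) <= 2^-1 ->
  bexp p s (fun G => (t <= `|Z G - mean|)%R%:R) <=
  3 * expR (- (t ^+ 2 / (8 * v))) + bad.
Proof.
move=> t0 hbad; set th := t / (4 * v) in hbad.
have th0 : 0 <= th by rewrite divr_ge0// mulr_ge0// ltW.
have u := upper_tail t th0; have l := lower_tail t th0 hbad.
have e : 2 * th ^+ 2 * v - th * t = - (t ^+ 2 / (8 * v)).
  by rewrite /th; field; rewrite gt_eqF.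
rewrite e in u l.
apply: (@le_trans _ _ (bexp p s (fun G => (good G && (mean + t <= Z G)%R)%:R +
   ((Z G <= mean - t)%R%:R + (~~ good G)%:R)))).
  apply: ler_bexp => // G _; case: (leP t _) => /= h; last by rewrite addr_ge0// addr_ge0.
  case: (good G) => /=; last by rewrite add0r lerDr.
  rewrite addr0; have [zm|zm] := leP (Z G) (mean - t); first by rewrite lerDr.
  case: (leP (mean + t) (Z G)) => //= zp; first by rewrite addr0.
  have : `|Z G - mean| < t by rewrite ltr_norml; lra.
  lra.
rewrite !bexpD -/bad; lra.
Qed.

End Concentration.

(** * Euclidean norms and operator norms *)

Section CauchySchwarz.
Variables (R : realType) (I : finType).

Lemma cauchy_schwarz_sum (a b : I -> R) :
  (\sum_i a i * b i) ^+ 2 <= (\sum_i a i ^+ 2) * (\sum_i b i ^+ 2).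
Proof.
have : 0 <= \sum_i \sum_j (a i * b j - a j * b i) ^+ 2.
  by apply: sumr_ge0 => i _; apply: sumr_ge0 => j _; exact: sqr_ge0.
have -> : \sum_i \sum_j (a i * b j - a j * b i) ^+ 2 =
   \sum_i \sum_j a i ^+ 2 * b j ^+ 2 + \sum_i \sum_j b i ^+ 2 * a j ^+ 2
   - 2 * \sum_i \sum_j (a i * b i) * (a j * b j).
  rewrite mulr_sumr -sumrN -!big_split/=; apply: eq_bigr => i _.
  rewrite mulr_sumr -sumrN -!big_split/=; apply: eq_bigr => j _; ring.
have e f g : \sum_i \sum_j f i * g j = (\sum_(i : I) f i) * (\sum_(j : I) g j) :> R.
  by rewrite mulr_suml; apply: eq_bigr => i _; rewrite mulr_sumr.
rewrite !e [X in _ + X - _]mulrC; rewrite expr2; lra.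
Qed.

End CauchySchwarz.

Section Dot.
Local Open Scope classical_set_scope.
Local Open Scope ring_scope.
Variables (R : realType) (n : nat).
Implicit Types (x y : 'cV[R]_n) (M : 'M[R]_n).

Definition dot x y : R := \sum_i x i 0 * y i 0.

Lemma dotC x y : dot x y = dot y x.
Proof. by apply: eq_bigr => i _; rewrite mulrC. Qed.

Lemma dotDl x y z : dot (x + y) z = dot x z + dot y z.
Proof. by rewrite -big_split; apply: eq_bigr => i _; rewrite mxE mulrDl. Qed.

Lemma dotZl c x y : dot (c *: x) y = c * dot x y.
Proof. by rewrite mulr_sumr; apply: eq_bigr => i _; rewrite mxE mulrA. Qed.

Lemma dotDr x y z : dot x (y + z) = dot x y + dot x z.
Proof. by rewrite dotC dotDl !(dotC x). Qed.

Lemma dotZr c x y : dot x (c *: y) = c * dot x y.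
Proof. by rewrite dotC dotZl dotC. Qed.

Lemma dot_ge0 x : 0 <= dot x x.
Proof. by apply: sumr_ge0 => i _; rewrite -expr2 sqr_ge0. Qed.

Lemma dot_eq0 x : dot x x = 0 -> x = 0.
Proof.
move/eqP; rewrite psumr_eq0; last by move=> i _; rewrite -expr2 sqr_ge0.
move=> /allP h; apply/matrixP => i j; rewrite ord1 mxE.
by have /eqP := h i (mem_index_enum _); rewrite -expr2 => /eqP; rewrite sqrf_eq0 => /eqP.
Qed.

Lemma dot_mulmx M x y : dot x (M *m y) = \sum_i \sum_j M i j * x i 0 * y j 0.
Proof.
apply: eq_bigr => i _; rewrite mxE mulr_sumr; apply: eq_bigr => j _; ring.
Qed.

Lemma dot_sym M x y : M^T = M -> dot x (M *m y) = dot y (M *m x).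
Proof.
move=> MT; rewrite !dot_mulmx exchange_big; apply: eq_bigr => i _; apply: eq_bigr => j _.
by rewrite -{1}MT mxE; ring.
Qed.

Lemma euclidean_normE x : euclidean_norm x = Num.sqrt (dot x x).
Proof. by congr Num.sqrt; apply: eq_bigr => i _; rewrite expr2. Qed.

Lemma euclidean_norm_ge0 x : 0 <= euclidean_norm x.
Proof. exact: sqrtr_ge0. Qed.

Lemma sqr_euclidean_norm x : euclidean_norm x ^+ 2 = dot x x.
Proof. by rewrite euclidean_normE sqr_sqrtr// dot_ge0. Qed.

Lemma euclidean_normZ c x : euclidean_norm (c *: x) = `|c| * euclidean_norm x.
Proof.
by rewrite !euclidean_normE dotZl dotZr mulrA -expr2 sqrtrM ?sqr_ge0// sqrtr_sqr.
Qed.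

Lemma dot_le x y : dot x y <= euclidean_norm x * euclidean_norm y.
Proof.
apply: le_trans (ler_norm _) _.
rewrite -sqrtr_sqr !euclidean_normE -sqrtrM ?dot_ge0// ler_wsqrtr//.
have := cauchy_schwarz_sum (fun i => x i 0) (fun i => y i 0).
by rewrite /dot; under [X in X * _]eq_bigr do rewrite expr2; under [X in _ * X]eq_bigr do rewrite expr2.
Qed.

Lemma euclidean_normD x y :
  euclidean_norm (x + y) <= euclidean_norm x + euclidean_norm y.
Proof.
rewrite -(@ler_pXn2r _ 2)// ?nnegrE ?addr_ge0 ?euclidean_norm_ge0//.
rewrite sqr_euclidean_norm dotDl !dotDr (dotC y x) sqrrD !sqr_euclidean_norm.
have := dot_le x y; lra.
Qed.

Lemma mulmx_norm_le M x :
  euclidean_norm (M *m x) <= Num.sqrt (\sum_i \sum_j M i j ^+ 2) * euclidean_norm x.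
Proof.
have M0 : 0 <= \sum_i \sum_j M i j ^+ 2.
  by apply: sumr_ge0 => i _; apply: sumr_ge0 => j _; exact: sqr_ge0.
rewrite /euclidean_norm -sqrtrM// ler_wsqrtr// mulr_suml.
apply: ler_sum => i _; rewrite mxE; exact: cauchy_schwarz_sum.
Qed.

Lemma opnorm_has_sup M :
  has_sup [set euclidean_norm (M *m x) | x in [set x : 'cV[R]_n | euclidean_norm x <= 1]].
Proof.
split.
  exists (euclidean_norm (M *m 0)); exists 0 => //=.
  by rewrite -(scale0r (0 : 'cV[R]_n)) euclidean_normZ normr0 mul0r ler01.
exists (Num.sqrt (\sum_i \sum_j M i j ^+ 2)) => _ [x /= x1 <-].
apply: le_trans (mulmx_norm_le _ _) _.
by rewrite -[leRHS]mulr1; apply: ler_wpM2l => //; exact: sqrtr_ge0.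
Qed.

Lemma opnorm_ub M x : euclidean_norm x <= 1 -> euclidean_norm (M *m x) <= opnorm M.
Proof. by move=> x1; apply: (sup_upper_bound (opnorm_has_sup M)); exists x. Qed.

Lemma opnorm_le M c : (forall x, euclidean_norm x <= 1 -> euclidean_norm (M *m x) <= c) ->
  opnorm M <= c.
Proof.
move=> h; apply: sup_le_ub; first by case: (opnorm_has_sup M).
by move=> _ [x /= x1 <-]; exact: h.
Qed.

Lemma opnorm_ge0 M : 0 <= opnorm M.
Proof.
apply: le_trans (opnorm_ub M (x := 0) _); first exact: euclidean_norm_ge0.
by rewrite -(scale0r (0 : 'cV[R]_n)) euclidean_normZ normr0 mul0r ler01.
Qed.

Lemma quadratic_le_opnorm M x : euclidean_norm x = 1 -> dot x (M *m x) <= opnorm M.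
Proof.
move=> x1; apply: le_trans (dot_le _ _) _; rewrite x1 mul1r.
by apply: opnorm_ub; rewrite x1.
Qed.

End Dot.

(** * Nonnegative top eigenvectors *)

Section Perron.
Local Open Scope classical_set_scope.
Local Open Scope ring_scope.
Variables (R : realType) (n : nat) (M : 'M[R]_n.+1).
Hypotheses (MT : M^T = M) (M0 : forall i j, 0 <= M i j).

Let q x : R := dot x (M *m x).

(** Compactness of the unit sphere, and homogeneity. *)
Lemma quadratic_max : exists2 c : 'cV[R]_n.+1, dot c c = 1 &
  forall x, q x <= q c * dot x x.
Proof.
have qZ k x : q (k *: x) = k ^+ 2 * q x.
  by rewrite /q -scalemxAr dotZl dotZr mulrA expr2.
pose A := [set v : 'rV[R]_n.+1 | dot v^T v^T = 1].
have cf (f : 'I_n.+1 -> 'rV[R]_n.+1 -> R) : (forall i, continuous (f i)) ->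
    continuous (fun v => \sum_i f i v).
  by move=> h; apply: continuous_big => //; exact: add_continuous.
have cc i : continuous (fun v : 'rV[R]_n.+1 => v^T i 0).
  rewrite (_ : (fun v : 'rV[R]_n.+1 => _) = (fun v => v 0 i)); first exact: coord_continuous.
  by apply/funext => v; rewrite mxE.
have cM (f g : 'rV[R]_n.+1 -> R) : continuous f -> continuous g ->
    continuous (fun v => f v * g v) by move=> hf hg v; exact: cvgM (hf v) (hg v).
have cA : compact A.
  apply: (@subclosed_compact _ _
    [set v : 'rV[R]_n.+1 | forall i, v ord0 i \in `[(-1 : R), 1]]).
  - have -> : A = (fun v : 'rV[R]_n.+1 => dot v^T v^T) @^-1` [set x | x = 1] by [].
    apply: preimage_closed; last exact: closed_eq.
    move=> v _; by apply: (cf) => i; apply: (cM); exact: cc.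
  - by apply: (@rV_compact _ _ (fun=> `[(-1 : R), 1]%classic)) => i; exact: segment_compact.
  - move=> v /= v1 i; rewrite /= in_itv/= -ler_norml -(@ler_pXn2r _ 2)// ?nnegrE//.
    rewrite expr1n -v1 /dot (bigD1 i)//= !mxE real_normK ?num_real// expr2 lerDl.
    by apply: sumr_ge0 => j _; rewrite -expr2 sqr_ge0.
have A0 : A !=set0.
  exists (delta_mx 0 0); rewrite /A/= /dot (bigD1 ord0)//= big1 ?mxE ?eqxx/= ?mulr1 ?addr0//.
  by move=> i i0; rewrite !mxE (negPf i0)/= mulr0.
have cq : {within A, continuous (fun v : 'rV[R]_n.+1 => q v^T)}.
  apply: continuous_subspaceT; apply: (cf) => i.
  apply: (cM (fun v => v^T i 0) (fun v => (M *m v^T) i 0)); first exact: cc.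
  rewrite (_ : (fun v : 'rV[R]_n.+1 => _) = (fun v => \sum_j M i j * v^T j 0)); last first.
    by apply/funext => u; rewrite mxE.
  apply: (cf) => j; apply: (cM (fun=> M i j) (fun v => v^T j 0)); last exact: cc.
  exact: cst_continuous.
have [c /set_mem Ac cmax] := EVT_max_rV A0 cA cq.
exists c^T => // x; have [x0|x0] := eqVneq (dot x x) 0.
  by rewrite (dot_eq0 x0) /q mulmx0 -(scale0r (0 : 'cV[R]_n.+1)) !dotZl !mul0r mulr0.
have xp : 0 < dot x x by rewrite lt_neqAle eq_sym x0 dot_ge0.
have := cmax ((Num.sqrt (dot x x))^-1 *: x)^T.
rewrite trmxK qZ exprVn sqr_sqrtr ?dot_ge0// mulrC ler_pdivrMr//; apply.
apply/mem_set; rewrite /A/= trmxK dotZl dotZr mulrA -expr2 exprVn sqr_sqrtr ?dot_ge0//.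
by rewrite mulVf.
Qed.

(** Replacing a maximizer of the quadratic form by its entrywise absolute value
    does not decrease the form, so there is a nonnegative maximizer [v]; it is
    an eigenvector because the form [lam * |y|^2 - q y] is nonnegative and
    vanishes at [v].  The maximum bounds [|q|] everywhere, again by absolute
    values, and polarization identifies it with the operator norm. *)
Theorem perron : exists2 v : 'cV[R]_n.+1,
  (forall i, 0 <= v i 0) /\ dot v v = 1 & M *m v = opnorm M *: v.
Proof.
have [c c1 cmax] := quadratic_max; set lam := q c in cmax.
have abs_q x : `|q x| <= q (\col_i `|x i 0|).
  rewrite /q !dot_mulmx; apply: le_trans (ler_norm_sum _ _ _) _.
  apply: ler_sum => i _; apply: le_trans (ler_norm_sum _ _ _) _.
  by apply: ler_sum => j _; rewrite !normrM !mxE (ger0_norm (M0 _ _)).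
have abs_dot (x : 'cV[R]_n.+1) : dot (\col_i `|x i 0|) (\col_i `|x i 0|) = dot x x :> R.
  by apply: eq_bigr => i _; rewrite !mxE -normrM ger0_norm// -expr2 sqr_ge0.
(* The entrywise absolute value of the maximizer is again a maximizer. *)
pose v : 'cV[R]_n.+1 := \col_i `|c i 0|.
have vv : dot v v = 1 by rewrite abs_dot.
have v0 i : 0 <= v i 0 by rewrite mxE.
have qv : q v = lam.
  apply/eqP; rewrite eq_le; apply/andP; split.
    by have := cmax v; rewrite vv mulr1.
  exact: le_trans (ler_norm _) (abs_q c).
have lam0 : 0 <= lam.
  rewrite -qv /q dot_mulmx; apply: sumr_ge0 => i _; apply: sumr_ge0 => j _.
  by rewrite !mulr_ge0.
have qge x : - (lam * dot x x) <= q x.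
  rewrite lerNl; apply: le_trans (ler_norm _) _; rewrite normrN.
  by apply: le_trans (abs_q x) _; rewrite -(abs_dot x) cmax.
have Mv : M *m v = lam *: v.
  pose r := M *m v - lam *: v.
  suff /dot_eq0/eqP : dot r r = 0 by rewrite subr_eq0 => /eqP.
  have rr : dot r r = dot r (M *m v) - lam * dot r v.
    by rewrite -dotZr -mulN1r -dotZr scaleN1r -dotDr.
  clearbody r.
  pose K := lam * dot r r - q r.
  have K0 : 0 <= K by rewrite subr_ge0.
  have key s : 2 * s * dot r r <= s ^+ 2 * K.
    have := cmax (v + s *: r); rewrite /q mulmxDr -scalemxAr.
    rewrite !dotDl !dotDr !dotZl !dotZr (dot_sym v r MT) (dotC v r) vv.
    rewrite -[dot v (M *m v)]/(q v) qv -[dot r (M *m r)]/(q r).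
    by rewrite /K rr; lra.
  apply/eqP; rewrite eq_le dot_ge0 andbT leNgt; apply/negP => r0.
  have := key (dot r r / (K + 1)); rewrite leNgt => /negP; apply.
  rewrite exprMn exprVn mulrAC ltr_pdivrMr ?exprn_gt0 ?ltr_wpDl//.
  have -> : 2 * (dot r r / (K + 1)) * dot r r * (K + 1) ^+ 2 = 2 * dot r r ^+ 2 * (K + 1).
    by field; rewrite gt_eqF// ltr_wpDl.
  have : 0 < dot r r ^+ 2 by rewrite exprn_gt0.
  by move=> h; have := mulr_ge0 (ltW h) K0; lra.
(* Polarization with [y] the normalized image of [x] bounds the norm of that
   image by [lam]. *)
suff -> : opnorm M = lam by exists v.
apply/eqP; rewrite eq_le; apply/andP; split; last first.
  by rewrite -qv; apply: quadratic_le_opnorm; rewrite euclidean_normE vv sqrtr1.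
apply: opnorm_le => x x1.
have [->|nx] := eqVneq (euclidean_norm (M *m x)) 0; first by [].
have np : 0 < euclidean_norm (M *m x) by rewrite lt_neqAle eq_sym nx euclidean_norm_ge0.
have xx : dot x x <= 1.
  by rewrite -sqr_euclidean_norm expr_le1// euclidean_norm_ge0.
set rho := euclidean_norm (M *m x) in nx np *.
pose y := rho^-1 *: (M *m x).
have yy : dot y y = 1.
  by rewrite dotZl dotZr -sqr_euclidean_norm -/rho; field.
have xy : dot y (M *m x) = rho.
  by rewrite dotZl -sqr_euclidean_norm -/rho; field.
clearbody y.
have h1 := cmax (x + y); have h2 := qge (x + (-1) *: y).
have e2 : q (x + (-1) *: y) = q x - 2 * rho + q y.
  rewrite /q mulmxDr -scalemxAr !dotDl !dotDr !dotZl !dotZr (dot_sym x y MT) xy; ring.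
have e1 : q (x + y) = q x + 2 * rho + q y.
  rewrite /q mulmxDr !dotDl !dotDr (dot_sym x y MT) xy; ring.
rewrite e1 !dotDl !dotDr yy in h1; rewrite e2 !dotDl !dotDr !dotZl !dotZr yy in h2.
have : lam * dot x x <= lam * 1 by apply: ler_wpM2l.
lra.
Qed.

End Perron.

(** * Graphs as edge sets, and their quadratic forms *)

Section Graph.
Variables (R : realType) (n : nat).
Implicit Types (G : {set 'I_n * 'I_n}) (S H : {set 'I_n}) (f : 'I_n -> 'I_n -> R).

Definition edge_seq : seq ('I_n * 'I_n) := enum [pred e : 'I_n * 'I_n | (e.1 < e.2)%N].

Definition adj G : 'M[R]_n :=
  \matrix_(i, j) (((i, j) \in G) || ((j, i) \in G))%:R.

Definition degree G i : R := \sum_j adj G i j.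

Definition inner_edges G S : {set 'I_n * 'I_n} :=
  [set e in G | (e.1 \in S) && (e.2 \in S)].

Lemma mem_edge_seq e : (e \in edge_seq) = (e.1 < e.2)%N.
Proof. by rewrite mem_enum. Qed.

Lemma adj_ge0 G i j : 0 <= adj G i j.
Proof. by rewrite mxE. Qed.

Lemma adj_sym G : (adj G)^T = adj G.
Proof. by apply/matrixP => i j; rewrite !mxE orbC. Qed.

(** Passing between sums over ordered pairs and over edges; each edge is
    stored once, with its smaller end first. *)
Lemma adj_sum G f : G \subset edge_seq ->
  \sum_i \sum_j adj G i j * f i j = \sum_(e in G) (f e.1 e.2 + f e.2 e.1).
Proof.
move=> /fintype.subsetP GE.
have aE i j : adj G i j = ((i, j) \in G)%:R + ((j, i) \in G)%:R.
  rewrite mxE; case: (boolP ((i, j) \in G)) => /= [/GE|_]; last by rewrite add0r.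
  rewrite mem_edge_seq/= => ij; case: (boolP ((j, i) \in G)) => /= [/GE|_]; last by rewrite addr0.
  by rewrite mem_edge_seq/= => /(ltn_trans ij); rewrite ltnn.
rewrite (eq_bigr (fun i => \sum_j ((i, j) \in G)%:R * f i j + \sum_j ((j, i) \in G)%:R * f i j)); last first.
  by move=> i _; rewrite -big_split; apply: eq_bigr => j _; rewrite aE mulrDl.
rewrite big_split/= [X in _ + X]exchange_big/= !pair_big/= -big_split/=.
rewrite [RHS]big_mkcond; apply: eq_bigr => -[i j] _ /=.
by case: ifP; rewrite ?mul1r// !mul0r addr0.
Qed.

Lemma sum_degree G (w : 'I_n -> R) : G \subset edge_seq ->
  \sum_(e in G) (w e.1 + w e.2) = \sum_i degree G i * w i.
Proof.
move=> GE; rewrite -(adj_sum (fun i j => w i) GE).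
by apply: eq_bigr => i _; rewrite -mulr_suml.
Qed.

(** Layer-cake: each superlevel set of [w] spans at most [d] edges per vertex.
    The layers are removed one at a time, by subtracting from [w] its smallest
    nonzero value on the support. *)
Lemma sum_min_edges G H d (w : 'I_n -> R) : (forall i, 0 <= w i) ->
  (forall i, w i != 0 -> i \in H) ->
  (forall S, S \subset H -> #|inner_edges G S|%:R <= d * #|S|%:R :> R) ->
  \sum_(e in G) Num.min (w e.1) (w e.2) <= d * \sum_i w i.
Proof.
have [k] := ubnP #|[set i | w i != 0]|; elim: k w => // k IH w.
rewrite ltnS => wk w0 wH Gd; set S := [set i | w i != 0] in wk.
have [S0|] := boolP (S == finset.set0).
  have wz i : w i = 0.
    apply: contraTeq isT => wi; have : i \in S by rewrite /S inE.
    by rewrite (eqP S0) finset.in_set0.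
  rewrite big1 => [|e _]; last by rewrite !wz minxx.
  by rewrite big1 ?mulr0.
move=> /finset.set0Pn[i0 i0S].
have SP i : (i \in S) = (w i != 0) by rewrite /S inE.
have [i1 i1S i1min] : exists2 i1, i1 \in S & forall i, i \in S -> w i1 <= w i.
  by case: (arg_minP w i0S) => i1 ? ?; exists i1.
set m := w i1 in i1min.
have m0 : 0 < m by rewrite lt_neqAle w0 andbT eq_sym -SP.
pose w' i := if i \in S then w i - m else 0.
have w'0 i : 0 <= w' i by rewrite /w'; case: ifP => // iS; rewrite subr_ge0 i1min.
have h : \sum_(e in G) Num.min (w' e.1) (w' e.2) <= d * \sum_i w' i.
  apply: IH => //.
    apply: leq_trans _ wk; apply: proper_card; apply/properP; split.
      apply/fintype.subsetP => i; rewrite inE SP /w' SP; case: (eqVneq (w i) 0) => //= _.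
      by rewrite eqxx.
    by exists i1 => //; rewrite inE /w' i1S /m addrN eqxx.
  by move=> i; rewrite /w' SP; case: (eqVneq (w i) 0) => [_|/wH//]; rewrite eqxx.
have SH : S \subset H by apply/fintype.subsetP => i; rewrite SP => /wH.
have hS := ler_wpM2l (ltW m0) (Gd S SH).
have eG : \sum_(e in G) Num.min (w e.1) (w e.2) =
    \sum_(e in G) Num.min (w' e.1) (w' e.2) + m * #|inner_edges G S|%:R.
  have -> : m * #|inner_edges G S|%:R = \sum_(e in G) (if (e.1 \in S) && (e.2 \in S) then m else 0).
    rewrite -big_mkcondr/= (eq_bigl (fun e => e \in inner_edges G S)).
      by rewrite sumr_const mulr_natr.
    by move=> e; rewrite /inner_edges [in RHS]inE.
  rewrite -big_split; apply: eq_bigr => e _ /=; rewrite /w'.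
  case: (boolP (e.1 \in S)) => e1; case: (boolP (e.2 \in S)) => e2 /=.
  - by rewrite -addr_minl subrK.
  - move: e2; rewrite SP negbK => /eqP ->; rewrite addr0.
    by rewrite !min_r// subr_ge0 i1min.
  - move: e1; rewrite SP negbK => /eqP ->; rewrite addr0.
    by rewrite !min_l// subr_ge0 i1min.
  - move: e1 e2; rewrite !SP !negbK => /eqP -> /eqP ->.
    by rewrite minxx addr0.
have ew : \sum_i w i = \sum_i w' i + m * #|S|%:R.
  have -> : m * #|S|%:R = \sum_i (if i \in S then m else 0).
    by rewrite -big_mkcond/= sumr_const mulr_natr.
  rewrite -big_split; apply: eq_bigr => i _ /=; rewrite /w'; case: (boolP (i \in S)) => iS.
    by rewrite subrK.
  by move: iS; rewrite SP negbK => /eqP ->; rewrite addr0.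
rewrite eG ew; lra.
Qed.

(** Either [y <= eps * x], or [x] is at most [y / eps]. *)
Lemma young_cubic (x y eps : R) : 0 <= x -> 0 <= y -> 0 < eps ->
  x ^+ 3 * y <= eps * x ^+ 4 + eps ^- 3 * y ^+ 4.
Proof.
move=> x0 y0 e0; have [h|h] := leP y (eps * x).
  have h1 := ler_wpM2l (exprn_ge0 3 x0) h.
  have : 0 <= eps ^- 3 * y ^+ 4.
    by rewrite mulr_ge0 ?exprn_ge0// invr_ge0 exprn_ge0// ltW.
  by set t := _ * y ^+ 4; lra.
have xy : x <= eps^-1 * y by rewrite ler_pdivlMl// ltW.
have h1 : x ^+ 3 <= (eps^-1 * y) ^+ 3 by rewrite lerXn2r ?nnegrE// mulr_ge0// invr_ge0 ltW.
apply: ler_wpDl; first by rewrite mulr_ge0 ?exprn_ge0// ltW.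
apply: le_trans (ler_wpM2r y0 h1) _.
by rewrite exprMn exprVn -mulrA -exprSr.
Qed.

(** On each edge, separate the larger value from the smaller one by
    [young_cubic].  The fourth powers of the larger values are paid by the
    degrees, those of the smaller ones by the sparsity of subsets of [H]. *)
Lemma quartic_form_le G H (d Delta eps : R) (u : 'I_n -> R) :
  G \subset edge_seq -> 0 < eps ->
  (forall i, 0 <= u i) -> (forall i, u i != 0 -> i \in H) ->
  (forall S, S \subset H -> #|inner_edges G S|%:R <= d * #|S|%:R) ->
  (forall i, degree G i <= Delta) ->
  \sum_i \sum_j adj G i j * (u i ^+ 3 * u j) <=
  (2 * eps * Delta + 2 * eps ^- 3 * d) * \sum_i u i ^+ 4.
Proof.
move=> GE e0 u0 uH Gd Gdeg; rewrite (adj_sum (fun i j => u i ^+ 3 * u j) GE).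
have hm := sum_min_edges (w := fun i => u i ^+ 4) _ _ Gd.
have {hm} /= hm := hm (fun i => exprn_ge0 4 (u0 i)) _.
have {}hm : \sum_(e in G) Num.min (u e.1 ^+ 4) (u e.2 ^+ 4) <= d * \sum_i u i ^+ 4.
  by apply: hm => i; rewrite expf_eq0 => /uH.
have hM : \sum_(e in G) (u e.1 ^+ 4 + u e.2 ^+ 4) <= Delta * \sum_i u i ^+ 4.
  rewrite (sum_degree (fun i => u i ^+ 4) GE) mulr_sumr; apply: ler_sum => i _.
  by rewrite ler_wpM2r ?exprn_ge0.
apply: (@le_trans _ _ (\sum_(e in G) (2 * eps * (u e.1 ^+ 4 + u e.2 ^+ 4) +
     2 * eps ^- 3 * Num.min (u e.1 ^+ 4) (u e.2 ^+ 4)))); last first.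
  have e3 : 0 <= 2 * eps ^- 3 by rewrite mulr_ge0// invr_ge0 exprn_ge0// ltW.
  have e1 : 0 <= 2 * eps by rewrite mulr_ge0// ltW.
  have h1 := ler_wpM2l e3 hm; have h2 := ler_wpM2l e1 hM.
  rewrite big_split/= -!mulr_sumr; move: h1 h2.
  set A := \sum_(e in G) (_ + _); set B := \sum_(e in G) _; set C := \sum_i _.
  set E := eps ^- 3; lra.
apply: ler_sum => e _.
have key x y : 0 <= x -> x <= y -> x ^+ 3 * y + y ^+ 3 * x <=
    2 * eps * (x ^+ 4 + y ^+ 4) + 2 * eps ^- 3 * x ^+ 4.
  move=> x0 xy; have y0 := le_trans x0 xy; have := young_cubic y0 x0 e0.
  have h : x ^+ 3 * y <= y ^+ 3 * x.
    rewrite -subr_ge0 (_ : _ - _ = (x * y) * ((y - x) * (y + x))); last by ring.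
    by rewrite !mulr_ge0 ?subr_ge0// addr_ge0.
  have : 0 <= eps * x ^+ 4 by rewrite mulr_ge0 ?exprn_ge0// ltW.
  lra.
have [h|h] := leP (u e.1) (u e.2).
  by rewrite min_l ?lerXn2r ?nnegrE//; exact: key.
have hh : u e.2 ^+ 4 <= u e.1 ^+ 4 by rewrite lerXn2r ?nnegrE// ltW.
rewrite min_r//.
by have := key _ _ (u0 e.2) (ltW h); lra.
Qed.

End Graph.
Arguments edge_seq n : clear implicits.

(** * Delocalization of the top eigenvector *)

Section Delocalization.
Variables (R : realType) (n : nat).
Variables (G : {set 'I_n * 'I_n}) (v : 'I_n -> R).
(** The vector [v] is a unit eigenvector for [lam]; [a] is the level at which
    its entries are truncated.  All degrees are at most [Delta], and all but [h]
    of them at most [D].  Sets of at most [s0] vertices span at most [d] edges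
    per vertex, and [eps] balances the two terms of Young's inequality. *)
Variables (lam a d eps Delta D h s0 : R).
Hypotheses (GE : G \subset edge_seq n) (lam0 : 0 < lam) (a0 : 0 < a) (eps0 : 0 < eps).
Hypotheses (D0 : 0 <= D) (Delta0 : 0 <= Delta).
Hypotheses (v0 : forall i, 0 <= v i) (v1 : \sum_i v i ^+ 2 = 1).
Hypothesis (veig : forall i, \sum_j adj R G i j * v j = lam * v i).
Hypothesis Gdeg : forall i, degree R G i <= Delta.
Hypothesis Gheavy : #|[set i | D < degree R G i]|%:R <= h.
Hypothesis as0 : 1 <= a ^+ 2 * s0.
Hypothesis Gsparse : forall S : {set 'I_n}, #|S|%:R <= s0 ->
  #|inner_edges G S|%:R <= d * #|S|%:R :> R.
Hypothesis eps_small : 2 * eps * Delta + 2 * eps ^- 3 * d <= lam / 2.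

Let u i := Num.max 0 (v i - a).
Let H := [set i | a < v i].

Let u0 i : 0 <= u i. Proof. by rewrite /u le_max lexx. Qed.

Let uH i : u i != 0 -> i \in H.
Proof. by rewrite inE ltNge; apply: contra => va; rewrite /u max_l// subr_le0. Qed.

Let uNH i : i \notin H -> u i = 0.
Proof. by apply: contraNeq; exact: uH. Qed.

Let vu i : i \in H -> v i = u i + a.
Proof. by rewrite inE => va; rewrite /u max_r ?subrK// subr_ge0 ltW. Qed.

Let card_H : #|H|%:R * a ^+ 2 <= 1 :> R.
Proof.
rewrite -[leRHS]v1 (bigID (mem H))/=; apply: ler_wpDr; first by apply: sumr_ge0 => i _; exact: sqr_ge0.
rewrite mulr_natl -sumr_const; apply: ler_sum => i; rewrite inE => /ltW va.
by rewrite lerXn2r ?nnegrE// ltW.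
Qed.

(** The eigenvalue equation tested against the cube of the excess [u] of [v]
    over the level [a].  The support of [u] has at most [s0] vertices as [v] is
    a unit vector, so its subsets are sparse and [quartic_form_le] applies; the
    part of [v] below [a] contributes at most [a] times the degree at each
    vertex, and few vertices have degree above [D]. *)
Lemma excess_quartic : \sum_i u i ^+ 4 <=
  256 * a ^+ 4 * ((D / lam) ^+ 4 / a ^+ 2 + h * (Delta / lam) ^+ 4).
Proof.
have q : \sum_i \sum_j adj R G i j * (u i ^+ 3 * u j) <= lam / 2 * \sum_i u i ^+ 4.
  apply: (le_trans (quartic_form_le (d := d) GE eps0 u0 uH _ Gdeg)); last first.
    by rewrite ler_wpM2r ?sumr_ge0// => i _; exact: exprn_ge0.
  move=> S SH; apply: Gsparse; apply: (@le_trans _ _ #|H|%:R).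
    by rewrite ler_nat subset_leq_card.
  have a20 : 0 < a ^+ 2 by rewrite exprn_gt0.
  rewrite -(ler_pM2r a20); apply: (le_trans card_H); rewrite mulrC; exact: as0.
have e1 : lam * \sum_i u i ^+ 4 <= \sum_i degree R G i * (a * u i ^+ 3) +
    \sum_i \sum_j adj R G i j * (u i ^+ 3 * u j).
  rewrite mulr_sumr -big_split; apply: ler_sum => i _ /=.
  apply: (@le_trans _ _ (u i ^+ 3 * (lam * v i))).
    case: (boolP (i \in H)) => [iH|/uNH ->]; last by rewrite !expr0n/= mul0r mulr0.
    rewrite (vu iH) (_ : lam * u i ^+ 4 = u i ^+ 3 * (lam * u i)); last by ring.
    by rewrite ler_wpM2l ?exprn_ge0// ler_pM2l// lerDl ltW.
  rewrite -veig mulr_sumr /degree mulr_suml -big_split; apply: ler_sum => j _ /=.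
  have : v j <= a + u j.
    case: (boolP (j \in H)) => [jH|jH]; first by rewrite (vu jH) addrC.
    by rewrite (uNH jH) addr0; move: jH; rewrite inE -leNgt.
  move=> /(ler_wpM2l (mulr_ge0 (exprn_ge0 3 (u0 i)) (adj_ge0 R G i j))); lra.
have e2 : \sum_i degree R G i * (a * u i ^+ 3) <=
   lam / 4 * \sum_i u i ^+ 4 + lam * (64 * a ^+ 4 * ((D / lam) ^+ 4 / a ^+ 2 + h * (Delta / lam) ^+ 4)).
  have deg0 i : 0 <= degree R G i by apply: sumr_ge0 => j _; exact: adj_ge0.
  apply: (@le_trans _ _ (lam / 4 * \sum_i u i ^+ 4 +
      lam * (64 * a ^+ 4 * \sum_(i in H) (degree R G i / lam) ^+ 4))).
    rewrite [X in _ * (_ * X)]big_mkcond/= !mulr_sumr -big_split; apply: ler_sum => i _ /=.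
    case: ifP => [iH|/negbT/uNH ->]; last by rewrite !expr0n/= !mulr0 addr0.
    set t := degree R G i / lam.
    have t0 : 0 <= t by rewrite divr_ge0// ltW.
    have -> : degree R G i = lam * t by rewrite /t mulrC divfK// gt_eqF.
    suff : (a * t) * u i ^+ 3 <= 4^-1 * u i ^+ 4 + 64 * (a * t) ^+ 4.
      by move/(ler_wpM2l (ltW lam0)); rewrite exprMn; lra.
    have at0 : 0 <= a * t by rewrite mulr_ge0// ltW.
    rewrite mulrC; apply: le_trans (young_cubic (u0 i) at0 (_ : 0 < 4^-1)) _; first by [].
    by rewrite exprVn invrK; apply: lerD => //; rewrite ler_wpM2r ?exprn_ge0//; lra.
  rewrite lerD2l ler_pM2l// ler_wpM2l//; first by rewrite mulr_ge0// exprn_ge0// ltW.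
  have p4 x : 0 <= (x / lam) ^+ 4 by rewrite exprMn exprVn -[4%N]/(2 * 2)%N !exprM mulr_ge0 ?invr_ge0 ?sqr_ge0.
  apply: (@le_trans _ _ (\sum_(i in H) ((D / lam) ^+ 4 +
     (if D < degree R G i then (Delta / lam) ^+ 4 else 0)))).
    apply: ler_sum => i _; case: ltP => hD.
      apply: ler_wpDl => //; rewrite lerXn2r ?nnegrE ?divr_ge0 ?(ltW lam0)//.
      by rewrite ler_pM2r ?invr_gt0.
    by rewrite addr0 lerXn2r ?nnegrE ?divr_ge0 ?(ltW lam0)// ler_pM2r ?invr_gt0.
  rewrite big_split/=; apply: lerD.
    rewrite sumr_const -mulr_natl mulrC; apply: ler_wpM2l => //.
    by rewrite -[_^-1]mul1r ler_pdivlMr ?exprn_gt0.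
  rewrite -big_mkcondr/=; apply: le_trans (ler_wpM2r (p4 Delta) Gheavy).
  apply: (@le_trans _ _ (\sum_(i in [set i | D < degree R G i]) (Delta / lam) ^+ 4)).
    rewrite [leRHS]big_mkcond [leLHS]big_mkcond; apply: ler_sum => i _.
    by rewrite inE; case: (i \in H) => //=; case: ifP.
  by rewrite sumr_const mulr_natl.
have : lam * (4^-1 * \sum_i u i ^+ 4) <= lam * (64 * a ^+ 4 * ((D / lam) ^+ 4 / a ^+ 2 + h * (Delta / lam) ^+ 4)).
  lra.
rewrite ler_pM2l//; lra.
Qed.

(** The influence is at most [2 * Delta] times the sum of the fourth powers of
    [v], of which the part below the level [a] contributes at most [a ^ 2]. *)
Theorem influence_bound : 4 * \sum_(e in G) (v e.1 * v e.2) ^+ 2 <=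
  2 * Delta * (9 * a ^+ 2 +
     8 * 256 * a ^+ 4 * ((D / lam) ^+ 4 / a ^+ 2 + h * (Delta / lam) ^+ 4)).
Proof.
have e1 : 4 * \sum_(e in G) (v e.1 * v e.2) ^+ 2 <= 2 * (Delta * \sum_i v i ^+ 4).
  have : \sum_(e in G) (v e.1 ^+ 4 + v e.2 ^+ 4) <= Delta * \sum_i v i ^+ 4.
    rewrite (sum_degree (fun i => v i ^+ 4) GE) mulr_sumr; apply: ler_sum => i _.
    by rewrite ler_wpM2r ?exprn_ge0.
  have : 2 * \sum_(e in G) (v e.1 * v e.2) ^+ 2 <= \sum_(e in G) (v e.1 ^+ 4 + v e.2 ^+ 4).
    rewrite mulr_sumr; apply: ler_sum => e _.
    have := sqr_ge0 (v e.1 ^+ 2 - v e.2 ^+ 2); lra.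
  lra.
apply: (le_trans e1); rewrite -mulrA ler_pM2l// ler_wpM2l//.
have hu := excess_quartic.
suff : \sum_i v i ^+ 4 <= a ^+ 2 * \sum_i v i ^+ 2 + 8 * \sum_i u i ^+ 4 + 8 * a ^+ 2 * (#|H|%:R * a ^+ 2).
  rewrite v1 mulr1; have := ler_wpM2l (sqr_ge0 a) card_H; lra.
have -> : 8 * a ^+ 2 * (#|H|%:R * a ^+ 2) = \sum_i (if i \in H then 8 * a ^+ 4 else 0).
  by rewrite -big_mkcond/= sumr_const -mulr_natr; ring.
rewrite !mulr_sumr -!big_split; apply: ler_sum => i _ /=; case: ifP => iH.
  rewrite (vu iH); have := sqr_ge0 (u i ^+ 2 - a ^+ 2); have := sqr_ge0 (u i - a).
  have := u0 i; set x := u i => x0 h1 h2.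
  have : 0 <= a ^+ 2 * (x + a) ^+ 2 by rewrite mulr_ge0 ?sqr_ge0.
  have : 0 <= (x - a) ^+ 2 * (7 * x ^+ 2 + 10 * a * x + 7 * a ^+ 2).
    rewrite mulr_ge0// !addr_ge0// ?mulr_ge0 ?sqr_ge0// ltW//.
  lra.
rewrite addr0 (uNH (negbT iH)) expr0n/= mulr0 addr0.
have va : v i <= a by move: iH; rewrite inE => /negbT; rewrite -leNgt.
rewrite (_ : v i ^+ 4 = v i ^+ 2 * v i ^+ 2); last by ring.
by rewrite ler_wpM2r ?sqr_ge0// lerXn2r ?nnegrE// ltW.
Qed.

End Delocalization.

(** * Tail bounds for edge counts *)

Section CountTails.
Variables (R : realType) (T : finType) (p : R) (s : seq T).
Hypotheses (p01 : 0 <= p <= 1) (us : uniq s).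
Implicit Types (F G : {set T}).

(** The Laplace transform of a binomial variable, bounded through
    [1 + y <= expR y]. *)
Lemma bexp_expR_count F (th : R) :
  bexp p s (fun G => expR (th * #|G :&: F|%:R)) <=
  expR (p * (expR th - 1) * (count (mem F) s)%:R).
Proof.
elim: s us => [|e s' IH] /=.
  by move=> _; rewrite finset.set0I cards0 !mulr0 expR0.
move=> /andP[es us']; have {}IH := IH us'.
set E := bexp p s' _ in IH *.
have E0 : 0 <= E by apply: bexp_ge0 => // G _; exact: expR_ge0.
have -> : bexp p s' (fun G => expR (th * #|(e |: G) :&: F|%:R)) =
    (if e \in F then expR th else 1) * E.
  rewrite -bexpZ; apply: eq_bexp => G /(subset_notin es) eG.
  rewrite finset.setIUl; case: ifP => eF.
    have -> : [set e] :&: F = [set e]%SET by apply/finset.setIidPl; rewrite finset.sub1set.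
    by rewrite cardsU1 inE (negPf eG)/= natrD mulrDr mulr1 expRD.
  have -> : [set e] :&: F = finset.set0.
    by apply/disjoint_setI0; rewrite disjoints1 eF.
  by rewrite finset.set0U mul1r.
case: (e \in F) => /=; last by rewrite add0n mul1r -mulrDl subrK mul1r.
rewrite natrD mulrDr mulr1 expRD mulrA -mulrDl; apply: ler_pM => //.
  case/andP: p01 => p0 p1.
  by rewrite addr_ge0 ?mulr_ge0 ?expR_ge0 ?subr_ge0.
by apply: le_trans (expR_ge1Dx _); lra.
Qed.

Lemma upper_count F (th x : R) : 0 <= th ->
  bexp p s (fun G => (x <= #|G :&: F|%:R)%R%:R) <=
  expR (p * expR th * (count (mem F) s)%:R - th * x).
Proof.
move=> th0; apply: (@le_trans _ _ (expR (- (th * x)) * expR (p * (expR th - 1) * (count (mem F) s)%:R))).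
  apply: le_trans (ler_wpM2l (expR_ge0 _) (bexp_expR_count F th)).
  rewrite -bexpZ; apply: ler_bexp => // G _; rewrite -expRD.
  case: (leP x _) => h; last exact: expR_ge0.
  by rewrite -[leLHS]expR0 ler_expR addrC subr_ge0 ler_wpM2l.
case/andP: p01 => p0 p1.
by rewrite -expRD ler_expR addrC lerD2r ler_wpM2r// ler_wpM2l// gerBl.
Qed.

Lemma lower_count F (x : R) :
  bexp p s (fun G => (#|G :&: F|%:R <= x)%R%:R) <=
  expR (x - p * (1 - expR (-1)) * (count (mem F) s)%:R).
Proof.
apply: (@le_trans _ _ (expR x * expR (p * (expR (-1) - 1) * (count (mem F) s)%:R))).
  apply: le_trans (ler_wpM2l (expR_ge0 _) (bexp_expR_count F _)).
  rewrite -bexpZ; apply: ler_bexp => // G _; rewrite -expRD.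
  case: (leP _ x) => h; last exact: expR_ge0.
  by rewrite -[leLHS]expR0 ler_expR; lra.
rewrite -expRD ler_expR; lra.
Qed.

Lemma bexp_union (I : finType) (r : pred I) (Q : I -> {set T} -> bool) :
  bexp p s (fun G => [exists i, r i && Q i G]%:R) <=
  \sum_(i | r i) bexp p s (fun G => (Q i G)%:R).
Proof.
rewrite -bexp_sum; apply: ler_bexp => // G _.
case: existsP => [[i /andP[ri qi]]|_]; last by apply: sumr_ge0.
by rewrite (bigD1 i)//= qi lerDl sumr_ge0.
Qed.

End CountTails.

Section Binomial.
Variable R : realType.

(** Keep a single term of [(1 + y) ^ n <= expR (n * y)] at [y = k / n]. *)
Lemma binomial_le_expR (n k : nat) : (0 < k)%N -> (k <= n)%N ->
  'C(n, k)%:R <= expR (k%:R * (1 + ln (n%:R / k%:R))) :> R.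
Proof.
move=> k0 kn; have n0 : (0 < n)%N := leq_trans k0 kn.
pose y : R := k%:R / n%:R.
have y0 : 0 < y by rewrite divr_gt0 ?ltr0n.
have h : 'C(n, k)%:R * y ^+ k <= expR (k%:R).
  apply: (@le_trans _ _ ((1 + y) ^+ n)).
    rewrite exprDn.
    have kn' : (k < n.+1)%N by [].
    rewrite (bigD1 (Ordinal kn'))//= expr1n mul1r mulr_natl lerDl.
    apply: sumr_ge0 => i _; rewrite expr1n mul1r mulrn_wge0// exprn_ge0// ltW//.
  apply: (@le_trans _ _ (expR y ^+ n)).
    by rewrite lerXn2r ?nnegrE ?expR_ge0 ?expR_ge1Dx// addr_ge0 ?ltW.
  by rewrite -expRM_natl /y mulrC divfK// pnatr_eq0 -lt0n.
rewrite mulrDr mulr1 expRD expRM_natl lnK ?posrE ?divr_gt0 ?ltr0n//.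
rewrite -ler_pdivrMr; last by rewrite exprn_gt0 ?divr_gt0 ?ltr0n.
by rewrite -exprVn invf_div.
Qed.

Lemma expR1_lt3 : expR 1 < 3 :> R.
Proof.
(* [expR (1 / 8) <= 8 / 7] and [(8 / 7) ^ 8 < 3]. *)
have h : expR (2^-1 ^+ 3) <= 8 / 7 :> R.
  rewrite (_ : 8 / 7 = (1 - 2^-1 ^+ 3)^-1); last by field.
  by apply: expR_le_inv; rewrite !exprS expr0; lra.
have -> : 1 = 8%:R * (2^-1 ^+ 3) :> R by rewrite !exprS expr0; field.
rewrite expRM_natl; apply: (@le_lt_trans _ _ ((8 / 7) ^+ 8)).
  by rewrite lerXn2r ?nnegrE ?expR_ge0//; lra.
rewrite !exprS expr0; lra.
Qed.

Lemma expR1_le3 : expR 1 <= 3 :> R.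
Proof. exact: ltW expR1_lt3. Qed.

Lemma expR1_ge2 : 2 <= expR 1 :> R.
Proof. by have := @expR_ge1Dx R 1; lra. Qed.

End Binomial.

(** * Degrees, edge number and small subgraphs of the random graph *)

Section GoodEvent.
Variables (R : realType) (n : nat) (p : R).
Hypothesis p01 : 0 <= p <= 1.
Implicit Types (S : {set 'I_n}) (G : {set 'I_n * 'I_n}).

Let s := edge_seq n.
Let us : uniq s. Proof. exact: enum_uniq. Qed.
Let p0 : 0 <= p. Proof. by case/andP: p01. Qed.

Lemma count_mem_le (T : finType) (r : seq T) (F : {set T}) :
  uniq r -> (count (mem F) r <= #|F|)%N.
Proof.
move=> ur; rewrite -size_filter cardE; apply: uniq_leq_size; first exact: filter_uniq.
by move=> e; rewrite mem_filter mem_enum => /andP[].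
Qed.

Definition touching S : {set 'I_n * 'I_n} := [set e | (e.1 \in S) || (e.2 \in S)].

Lemma card_touching S : (#|touching S| <= 2 * n * #|S|)%N.
Proof.
have -> : touching S = finset.setX S [set: 'I_n] :|: finset.setX [set: 'I_n] S.
  by apply/setP => e; rewrite !inE andbT.
apply: leq_trans (leq_card_setU _ _) _; rewrite !cardsX cardsT card_ord.
by rewrite (mulnC #|S| n) addnn -mulnA mul2n.
Qed.

Lemma sum_degree_touching G S : G \subset s ->
  \sum_(i in S) degree R G i <= 2 * #|G :&: touching S|%:R.
Proof.
move=> GE; have := sum_degree (fun i => (i \in S)%:R : R) GE.
rewrite [X in _ = X](_ : _ = \sum_(i in S) degree R G i); last first.
  rewrite [RHS]big_mkcond; apply: eq_bigr => i _.
  by case: (i \in S); rewrite ?mulr1 ?mulr0.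
move=> <-; have -> : 2 * #|G :&: touching S|%:R = \sum_(e in G) (2 * (e \in touching S)%:R) :> R.
  rewrite -mulr_sumr; congr (_ * _); rewrite -sum1_card natr_sum.
  rewrite (eq_bigl (fun e => (e \in G) && (e \in touching S))); last by move=> e; rewrite finset.in_setI.
  by rewrite big_mkcondr/=; apply: eq_bigr => e _; case: (e \in touching S).
apply: ler_sum => e _; rewrite /touching inE.
by case: (e.1 \in S); case: (e.2 \in S) => /=; lra.
Qed.

(** At most [2 * n * #|S|] pairs touch [S]; the parameter of the exponential
    Markov inequality is 2, and [expR 2 <= 9]. *)
Lemma touching_tail S (x : R) :
  bexp p s (fun G => (x * #|S|%:R <= #|G :&: touching S|%:R)%R%:R) <=
  expR ((18 * (n%:R * p) - 2 * x) * #|S|%:R).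
Proof.
apply: (le_trans (@upper_count R _ p s p01 us _ 2 _ _)); first by lra.
rewrite ler_expR.
have e9 : expR 2 <= 9 :> R.
  have -> : 2 = 2%:R * 1 :> R by rewrite mulr1.
  rewrite expRM_natl; have := expR1_le3 R => h.
  have : expR 1 ^+ 2 <= 3 ^+ 2 :> R by rewrite lerXn2r ?nnegrE ?expR_ge0.
  lra.
have hc : (count (mem (touching S)) s)%:R <= 2 * n%:R * #|S|%:R :> R.
  rewrite -!natrM ler_nat; apply: leq_trans (card_touching S).
  exact: count_mem_le.
have h1 : p * expR 2 * (count (mem (touching S)) s)%:R <= p * 9 * (2 * n%:R * #|S|%:R).
  apply: ler_pM => //; first by rewrite mulr_ge0 ?expR_ge0.
  by rewrite ler_wpM2l.
lra.
Qed.

Lemma sum_draws (k : nat) (c : R) :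
  \sum_(S : {set 'I_n} | #|S| == k) c = 'C(n, k)%:R * c.
Proof.
rewrite sumr_const mulr_natl; congr (_ *+ _).
by rewrite -[X in 'C(X, _)](card_ord n) -card_draws; apply: eq_card => S; rewrite !inE.
Qed.

Lemma degree_tail (x : R) :
  bexp p s (fun G => [exists i, x < degree R G i]%:R) <=
  n%:R * expR (18 * (n%:R * p) - x).
Proof.
apply: (@le_trans _ _ (bexp p s (fun G => [exists S : {set 'I_n}, (#|S| == 1%N) &&
   (x / 2 * #|S|%:R <= #|G :&: touching S|%:R)%R]%:R))).
  apply: ler_bexp => // G Gs; case: existsP => [[i xi]|_] //.
  rewrite (_ : [exists _, _] = true)//; apply/existsP; exists [set i]%SET.
  rewrite cards1 eqxx mulr1/=.
  have := sum_degree_touching [set i]%SET Gs; rewrite big_set1; lra.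
apply: (le_trans (bexp_union _ p01 _ _)).
apply: (@le_trans _ _ (\sum_(S : {set 'I_n} | #|S| == 1%N) expR (18 * (n%:R * p) - x))).
  apply: ler_sum => S /eqP S1; apply: (le_trans (touching_tail S (x / 2))).
  by rewrite S1 mulr1 ler_expR; lra.
by rewrite sum_draws bin1.
Qed.

(** If [k] vertices have degree above [40 * n * p], then some set of [k]
    vertices is touched by at least [20 * n * p * k] edges. *)
Lemma heavy_tail (k : nat) :
  bexp p s (fun G => (k <= #|[set i | (40 * (n%:R * p) < degree R G i)%R]|)%N%:R) <=
  'C(n, k)%:R * expR (- (22 * (n%:R * p) * k%:R)).
Proof.
apply: (@le_trans _ _ (bexp p s (fun G => [exists S : {set 'I_n}, (#|S| == k) &&
   (20 * (n%:R * p) * #|S|%:R <= #|G :&: touching S|%:R)%R]%:R))).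
  apply: ler_bexp => // G Gs; case: leqP => // kH.
  rewrite (_ : [exists _, _] = true)//; apply/existsP.
  have [S SH Sk] : exists2 S : {set 'I_n},
     S \subset [set i | (40 * (n%:R * p) < degree R G i)%R] & #|S| = k.
    set H := [set i | _] in kH *.
    exists [set x in take k (enum H)].
      apply/fintype.subsetP => x; rewrite inE => /mem_take; by rewrite mem_enum.
    rewrite cardsE (card_uniqP _) ?take_uniq ?enum_uniq// size_take_min -cardE.
    exact/minn_idPl.
  exists S; rewrite Sk eqxx /=.
  have := sum_degree_touching S Gs.
  have : \sum_(i in S) (40 * (n%:R * p)) <= \sum_(i in S) degree R G i.
    by apply: ler_sum => i /(fintype.subsetP SH); rewrite inE => /ltW.
  rewrite sumr_const Sk -mulr_natr; lra.
apply: (le_trans (bexp_union _ p01 _ _)).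
apply: (@le_trans _ _ (\sum_(S : {set 'I_n} | #|S| == k) expR (- (22 * (n%:R * p) * k%:R)))).
  apply: ler_sum => S /eqP S1; apply: (le_trans (touching_tail S _)).
  by rewrite S1 ler_expR; lra.
by rewrite sum_draws.
Qed.

Lemma size_edge_seq : (size s)%:R = n%:R * (n%:R - 1) / 2 :> R.
Proof.
pose K : {set 'I_n * 'I_n} := [set e : 'I_n * 'I_n | (e.1 < e.2)%N].
have KE : K \subset s.
  by apply/fintype.subsetP => e; rewrite inE mem_edge_seq.
have Ks : #|K| = size s.
  by rewrite /s /edge_seq -cardE; apply: eq_card => e; rewrite !inE.
have := adj_sum (fun _ _ => 1 : R) KE.
rewrite sumr_const Ks; under eq_bigr do under eq_bigr do rewrite mulr1.
have -> : \sum_i \sum_j adj R K i j = n%:R * (n%:R - 1) :> R.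
  rewrite (eq_bigr (fun=> n%:R - 1)); first by rewrite sumr_const card_ord mulr_natl.
  move=> i _; rewrite (bigD1 i)//= mxE !inE/= ltnn/= add0r.
  rewrite (eq_bigr (fun=> 1)).
    rewrite sumr_const cardC1 card_ord -subn1 natrB//; exact: leq_ltn_trans (ltn_ord i).
  by move=> j ji; rewrite mxE !inE/= -neq_ltn eq_sym (inj_eq val_inj) ji.
by move=> ->; rewrite -mulr_natr; field.
Qed.

Lemma edge_count_tail :
  bexp p s (fun G => (#|G|%:R <= p * (size s)%:R / 4)%R%:R) <=
  expR (- (p * (size s)%:R / 4)).
Proof.
have := @lower_count R _ p s p01 us [set: 'I_n * 'I_n]%SET (p * (size s)%:R / 4).
have -> : count (mem [set: 'I_n * 'I_n]%SET) s = size s.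
  by rewrite -[RHS]count_predT; apply: eq_count => e; rewrite !inE.
under eq_fun do rewrite finset.setIT.
move/le_trans; apply; rewrite ler_expR expRN.
have h : (expR 1)^-1 <= 2^-1 :> R.
  by rewrite lef_pV2 ?posrE ?expR_gt0//; exact: expR1_ge2.
have : p * (size s)%:R * (expR 1)^-1 <= p * (size s)%:R * 2^-1.
  by rewrite ler_wpM2l// mulr_ge0.
lra.
Qed.

Lemma inner_edgesE G S : inner_edges G S = G :&: finset.setX S S.
Proof. by apply/setP => -[i j]; rewrite !inE. Qed.

(** Union bound over the sets [S] of a given size [k].  Such a set spans more
    than [d * k] edges only if [d < k], as there are at most [k ^ 2] pairs.  The
    expected number of edges in [S] is smaller than [d * k] by the factor
    [expR th], where [expR th = c1 * n / k] is at least 27, and the gain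
    [d * k * (th - 1)] in the exponent exceeds the entropy
    [k * (1 + ln (n / k))] by at least [d * k], which is more than [d ^ 2]. *)
Lemma sparse_tail (c1 d s0 : R) : 0 < p -> 0 < c1 -> d = c1 * (n%:R * p) ->
  s0 = c1 * n%:R / 27 -> 8 <= d -> - ln c1 <= d / 2 ->
  bexp p s (fun G => [exists S : {set 'I_n}, (#|S|%:R <= s0)%R &&
     (d * #|S|%:R < #|inner_edges G S|%:R)%R]%:R) <=
  n.+1%:R * expR (- d ^+ 2).
Proof.
move=> pp c10 dE s0E d8 lnc1.
have d0 : 0 < d by lra.
apply: (@le_trans _ _ (bexp p s (fun G => [exists S : {set 'I_n},
   ((#|S|%:R <= s0)%R && (d < #|S|%:R)%R) &&
     (d * #|S|%:R <= #|G :&: finset.setX S S|%:R)%R]%:R))).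
  apply: ler_bexp => // G Gs; case: existsP => [[S /andP[Ss0 Sd]]|_] //.
  rewrite (_ : [exists _, _] = true)//; apply/existsP; exists S.
  rewrite inner_edgesE in Sd; rewrite Ss0 (ltW Sd) andbT/=.
  have : #|G :&: finset.setX S S|%:R <= #|S|%:R * #|S|%:R :> R.
    by rewrite -natrM ler_nat -cardsX subset_leq_card// finset.subsetIr.
  move=> /(lt_le_trans Sd); case: (ltP 0 (#|S|%:R : R)) => [S0|S0]; first by rewrite ltr_pM2r.
  have -> : #|S|%:R = 0 :> R by apply/eqP; rewrite eq_le S0 ler0n.
  by rewrite !mulr0 ltxx.
apply: (le_trans (bexp_union _ p01 _ _)).
rewrite (partition_big (fun S : {set 'I_n} => inord #|S| : 'I_n.+1) xpredT)//=.
apply: (@le_trans _ _ (\sum_(k < n.+1) expR (- d ^+ 2))); last first.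
  by rewrite sumr_const card_ord mulr_natl.
apply: ler_sum => k _.
have cardS S : (inord #|S| == k) = (#|S| == k).
  by rewrite -val_eqE/= inordK// ltnS -[X in (_ <= X)%N](card_ord n) max_card.
under eq_bigl do rewrite cardS.
have [/andP[ks0 kd]|kN] := boolP ((k%:R <= s0)%R && (d < k%:R)%R); last first.
  rewrite big_pred0 ?expR_ge0// => S.
  by apply/negbTE; apply: contra kN => /andP[+ /eqP Sk]; rewrite Sk.
have k0 : (0 < k)%N by rewrite -(ltr0n R); exact: lt_trans d0 kd.
have kn : (k <= n)%N by rewrite -ltnS.
have n0 : (0 < n)%N := leq_trans k0 kn.
have kR : 0 < k%:R :> R by rewrite ltr0n.
have nR : 0 < n%:R :> R by rewrite ltr0n.
pose th : R := ln (c1 * n%:R / k%:R).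
have thE : th = ln c1 + ln (n%:R / k%:R).
  by rewrite /th -mulrA lnM ?posrE// divr_gt0.
have th3 : 3 <= th.
  rewrite -(expRK 3) ler_ln ?posrE ?expR_gt0 ?divr_gt0 ?mulr_gt0//.
  rewrite ler_pdivlMr//; have -> : 3 = 3%:R * 1 :> R by rewrite mulr1.
  rewrite expRM_natl; have := expR1_le3 R => h.
  have h2 : expR 1 ^+ 3 <= 3 ^+ 3 :> R by rewrite lerXn2r ?nnegrE ?expR_ge0.
  have := ler_wpM2r (ltW kR) h2; rewrite s0E in ks0; lra.
have tS S : #|S| == k -> bexp p s (fun G => (d * #|S|%:R <= #|G :&: finset.setX S S|%:R)%R%:R) <=
   expR (d * k%:R * (1 - th)).
  move=> /eqP Sk; apply: (le_trans (@upper_count R _ p s p01 us _ th _ _)); first by lra.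
  rewrite ler_expR Sk /th lnK ?posrE ?divr_gt0 ?mulr_gt0// -/th.
  have hc : (count (mem (finset.setX S S)) s)%:R <= k%:R * k%:R :> R.
    by rewrite -natrM ler_nat -{1}Sk -{1}Sk -cardsX; exact: count_mem_le.
  have h1 : p * (c1 * n%:R / k%:R) * (count (mem (finset.setX S S)) s)%:R <=
     p * (c1 * n%:R / k%:R) * (k%:R * k%:R).
    by rewrite ler_wpM2l// mulr_ge0// ltW// divr_gt0// mulr_gt0.
  have e : p * (c1 * n%:R / k%:R) * (k%:R * k%:R) = d * k%:R.
    by rewrite dE; field; rewrite gt_eqF.
  lra.
apply: (@le_trans _ _ (\sum_(S : {set 'I_n} | #|S| == k) expR (d * k%:R * (1 - th)))).
  rewrite [leRHS]big_mkcond [leLHS]big_mkcond; apply: ler_sum => S _.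
  case: (boolP (#|S| == k)) => Sk; last by rewrite andbF.
  by case: ifP => _; [exact: tS|exact: expR_ge0].
rewrite sum_draws; apply: (le_trans (ler_wpM2r (expR_ge0 _) (binomial_le_expR R k0 kn))).
rewrite -expRD ler_expR.
have h1 : (1 + ln (n%:R / k%:R)) + d * (1 - th) <= - d.
  have : 0 <= (d - 8) * (th - 3) by rewrite mulr_ge0// subr_ge0.
  lra.
have := ler_wpM2r (ltW kR) h1.
have : d * d <= d * k%:R by rewrite ler_pM2l// ltW.
lra.
Qed.

End GoodEvent.

(** * The norm of a graph and its certificates *)

Section GraphNorm.
Variables (R : realType) (n : nat).
Implicit Types (G : {set 'I_n * 'I_n}).

Definition graph_norm G : R := opnorm (adj R G).

Lemma graph_norm_bounds G : 0 <= graph_norm G <= n%:R.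
Proof.
rewrite opnorm_ge0/=; apply: opnorm_le => x x1.
apply: le_trans (mulmx_norm_le _ _) _.
rewrite -[leRHS]mulr1; apply: ler_pM; rewrite ?sqrtr_ge0 ?euclidean_norm_ge0//.
have -> : n%:R = Num.sqrt (\sum_(i < n) \sum_(j < n) 1) :> R.
  by rewrite !sumr_const card_ord -mulrnA natrM -expr2 sqrtr_sqr ger0_norm.
apply: ler_wsqrtr; apply: ler_sum => i _; apply: ler_sum => j _.
by rewrite mxE; case: (_ || _); rewrite ?expr1n ?expr0n.
Qed.

(** The constant unit vector as a test vector. *)
Lemma edges_le_graph_norm G : (0 < n)%N -> G \subset edge_seq n ->
  2 * #|G|%:R <= n%:R * graph_norm G.
Proof.
move=> n0 GE; have nR : 0 < n%:R :> R by rewrite ltr0n.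
pose x : 'cV[R]_n := const_mx (Num.sqrt n%:R)^-1.
have xx : dot x x = 1.
  rewrite /dot (eq_bigr (fun=> n%:R^-1)).
    by rewrite sumr_const card_ord -[LHS]mulr_natl mulfV// gt_eqF.
  by move=> i _; rewrite !mxE -expr2 exprVn sqr_sqrtr// ltW.
have := @quadratic_le_opnorm _ _ (adj R G) x.
rewrite euclidean_normE xx sqrtr1 => /(_ erefl).
rewrite dot_mulmx.
have -> : \sum_i \sum_j adj R G i j * x i 0 * x j 0 = \sum_i \sum_j adj R G i j * n%:R^-1.
  apply: eq_bigr => i _; apply: eq_bigr => j _.
  by rewrite !mxE -mulrA -expr2 exprVn sqr_sqrtr// ltW.
rewrite (adj_sum (fun _ _ => n%:R^-1) GE) sumr_const => h.
have := ler_wpM2l (ltW nR) h.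
rewrite -/(graph_norm G) -mulr_natr; apply: le_trans.
by rewrite le_eqVlt; apply/orP; left; apply/eqP; field; rewrite gt_eqF.
Qed.

Lemma sum_edge_seq G (f : 'I_n * 'I_n -> R) : G \subset edge_seq n ->
  \sum_(e <- edge_seq n) (if e \in G then f e else 0) = \sum_(e in G) f e.
Proof.
move=> /fintype.subsetP GE; rewrite /edge_seq big_enum_cond/= -big_mkcondr/=.
apply: eq_bigl => e; case: (boolP (e \in G)) => [/GE|_]; last by rewrite !andbF.
by rewrite mem_edge_seq inE => ->.
Qed.

(** The vector [v] attains the norm of [G] and is a test vector for [G'].  The
    products of its entries are nonnegative, so only the edges of [G] that are
    missing in [G'] have a cost. *)
Lemma graph_norm_certificate G (v : 'cV[R]_n) : G \subset edge_seq n ->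
  (forall i, 0 <= v i 0) -> dot v v = 1 ->
  adj R G *m v = graph_norm G *: v ->
  forall G', G' \subset edge_seq n ->
  graph_norm G - \sum_(e <- edge_seq n | (e \in G) != (e \in G'))
    (if e \in G then 2 * (v e.1 0 * v e.2 0) else 0) <= graph_norm G'.
Proof.
move=> GE v0 vv Gv G' G'E.
have q (X : {set 'I_n * 'I_n}) : X \subset edge_seq n -> dot v (adj R X *m v) =
    \sum_(e <- edge_seq n) (if e \in X then 2 * (v e.1 0 * v e.2 0) else 0).
  move=> XE; rewrite (sum_edge_seq (fun e => 2 * (v e.1 0 * v e.2 0)) XE) dot_mulmx.
  rewrite (eq_bigr (fun i => \sum_j adj R X i j * (v i 0 * v j 0))).
    rewrite (adj_sum (fun i j => v i 0 * v j 0) XE); apply: eq_bigr => e _; ring.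
  by move=> i _; apply: eq_bigr => j _; rewrite mulrA.
have e1 : dot v (adj R G *m v) = graph_norm G by rewrite Gv dotZr vv mulr1.
have e2 : dot v (adj R G' *m v) <= graph_norm G'.
  by apply: quadratic_le_opnorm; rewrite euclidean_normE vv sqrtr1.
apply: le_trans e2; rewrite -e1 !q// lerBlDr [X in _ <= _ + X]big_mkcond -big_split.
apply: ler_sum => e _ /=.
have w0 : 0 <= 2 * (v e.1 0 * v e.2 0) by rewrite !mulr_ge0.
by case: (e \in G); case: (e \in G') => /=; rewrite ?add0r ?addr0.
Qed.

Lemma graph_perron G : (0 < n)%N -> exists2 v : 'cV[R]_n,
  (forall i, 0 <= v i 0) /\ dot v v = 1 & adj R G *m v = graph_norm G *: v.
Proof.
rewrite /graph_norm; move: (adj_sym R G) (adj_ge0 R G); move: (adj R G).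
by case: n => // m A AT A0 _; exact: perron.
Qed.

End GraphNorm.

(** * Concentration of the norm of the random graph *)

Section CubeConcentration.
Variables (R : realType) (n : nat) (p c B E : R).
(** [B] and [E] stand for [2560] and [320 ^ 4].  With [d = k1 * x], the constant
    [c] in [k1 = c / M ^ 3] is so small that [2 * eps ^- 3 * d <= x / 32] for
    [eps = 1 / (B * M)]. *)
Let s := edge_seq n.
Let x : R := n%:R * p.
Let l : R := ln n%:R.
Let M : R := 1 + l / x.
Let T : R := x * M.
Hypotheses (n2 : (2 <= n)%N) (p0 : 0 < p) (p1 : p <= 1).
Hypotheses (c0 : 0 < c) (B_large : 40 * 64 <= B) (E_large : 320 ^+ 4 <= E) (c1 : c * (64 * B ^+ 3) <= 1).
Hypothesis Mx : 100 / c ^+ 2 * M ^+ 9 <= x.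

Let k1 : R := c / M ^+ 3.
Let d : R := k1 * x.
Let s0 : R := k1 * n%:R / 27.
Let k : nat := Num.truncn (s0 / M ^+ 4).
Let Delta : R := 40 * T.
Let D : R := 40 * x.
Let CV : R := 80 * 27 / c * (9 + 16 * 256 * E).

(** The typical properties of the random graph, as the negations of the events
    bounded by [degree_tail], [heavy_tail], [edge_count_tail] and
    [sparse_tail]. *)
Definition good_graph (G : {set 'I_n * 'I_n}) : bool :=
  [&& ~~ [exists i, Delta < degree R G i],
      ~~ (k <= #|[set i | (D < degree R G i)%R]|)%N,
      ~~ (#|G|%:R <= p * (size s)%:R / 4) &
      ~~ [exists S : {set 'I_n}, (#|S|%:R <= s0) && (d * #|S|%:R < #|inner_edges G S|%:R)]].

Let n0 : (0 < n)%N. Proof. exact: leq_trans n2. Qed.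
Let nR : 0 < n%:R :> R. Proof. by rewrite ltr0n. Qed.
Let x0 : 0 < x. Proof. by rewrite mulr_gt0. Qed.
Let n2R : 2 <= n%:R :> R. Proof. by rewrite (ler_nat _ 2). Qed.
Let l0 : 0 <= l. Proof. by apply: ln_ge0; apply: le_trans n2R; lra. Qed.
Let M1 : 1 <= M. Proof. by rewrite lerDl divr_ge0// ltW. Qed.
Let Mpos : 0 < M. Proof. exact: lt_le_trans M1. Qed.
Let TE : T = x + l. Proof. by rewrite /T /M; field; rewrite gt_eqF. Qed.
Let B0 : 0 < B. Proof. by apply: lt_le_trans B_large; rewrite mulr_gt0 ?ltr0n. Qed.
Let B1 : 1 <= B. Proof. by apply: le_trans B_large; rewrite -natrM ler1n. Qed.
Let c_small : c <= 64^-1.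
Proof.
have h : 1 <= B ^+ 3 by rewrite -(expr1n _ 3) lerXn2r ?nnegrE// ltW.
have := ler_wpM2l (ltW c0) h; have := c1; lra.
Qed.
Let E0 : 0 < E.
Proof. by apply: lt_le_trans E_large; apply: exprn_gt0; exact: ltr0Sn. Qed.
Let CV0 : 0 < CV.
Proof.
apply: mulr_gt0; first by apply: divr_gt0 => //; apply: mulr_gt0; exact: ltr0Sn.
apply: addr_gt0; first exact: ltr0Sn.
apply: mulr_gt0; last exact: E0.
by apply: mulr_gt0; exact: ltr0Sn.
Qed.
Let xn : x <= n%:R. Proof. by rewrite /x -[leRHS]mulr1 ler_wpM2l// ltW. Qed.

Let Mpow j : (j <= 9)%N -> 100 * M ^+ j <= c ^+ 2 * x.
Proof.
move=> j9; have h : M ^+ j <= M ^+ 9 by rewrite ler_weXn2l.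
have c20 : 0 < c ^+ 2 by rewrite exprn_gt0.
have := ler_wpM2l (ltW c20) Mx.
rewrite (_ : c ^+ 2 * (100 / c ^+ 2 * M ^+ 9) = 100 * M ^+ 9); first lra.
by field; rewrite gt_eqF.
Qed.

Let Mpow1 j : (j <= 9)%N -> 100 * M ^+ j <= c * x.
Proof.
move=> /Mpow/le_trans; apply; apply: ler_wpM2r; first exact: ltW.
by rewrite expr2 -[leRHS]mulr1 ler_pM2l//; have := c_small; lra.
Qed.

Let Mpow0 j : (j <= 9)%N -> 100 * M ^+ j <= x.
Proof.
move=> /Mpow1/le_trans; apply; rewrite -[leRHS]mul1r ler_pM2r//.
by have := c_small; lra.
Qed.

Let x100 : 100 <= x. Proof. by have := @Mpow0 0 isT; rewrite expr0 mulr1. Qed.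

Let k10 : 0 < k1. Proof. by rewrite divr_gt0// exprn_gt0. Qed.
Let d0 : 0 < d. Proof. by rewrite mulr_gt0. Qed.
Let s00 : 0 < s0. Proof. by rewrite /s0 divr_gt0// mulr_gt0. Qed.

Let dM : d * M ^+ 3 = c * x.
Proof. by rewrite /d /k1 mulrAC divfK// gt_eqF// exprn_gt0. Qed.

Let d8 : 8 <= d.
Proof.
rewrite -(ler_pM2r (exprn_gt0 3 Mpos)) dM; have := @Mpow1 3 isT.
have := exprn_gt0 3 Mpos; lra.
Qed.

Let ln_k1 : - ln k1 <= d / 2.
Proof.
rewrite -lnV ?posrE// /k1 invf_div.
have y0 : 0 < M ^+ 3 / c by rewrite divr_gt0// exprn_gt0.
have h : ln (M ^+ 3 / c) <= M ^+ 3 / c.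
  by have := @expR_ge1Dx R (ln (M ^+ 3 / c)); rewrite lnK ?posrE//; lra.
apply: (le_trans h); rewrite ler_pdivrMr// -(ler_pM2r (exprn_gt0 3 Mpos)).
rewrite (_ : d / 2 * c * M ^+ 3 = c / 2 * (d * M ^+ 3)); last by ring.
rewrite dM -exprD; have := @Mpow 6 isT; have := exprn_gt0 6 Mpos; lra.
Qed.

Let d2T : 5 * T <= d ^+ 2.
Proof.
rewrite -(ler_pM2r (exprn_gt0 6 Mpos)).
have -> : d ^+ 2 * M ^+ 6 = x * (c ^+ 2 * x).
  by rewrite (_ : d ^+ 2 * M ^+ 6 = (d * M ^+ 3) ^+ 2); [rewrite dM; ring|ring].
have -> : 5 * T * M ^+ 6 = x * (5 * M ^+ 7) by rewrite /T; ring.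
rewrite ler_pM2l//; have := @Mpow 7 isT; have := exprn_gt0 7 Mpos; lra.
Qed.

Let s0M : s0 * M ^+ 3 = c * n%:R / 27.
Proof. by rewrite /s0 /k1; field; rewrite gt_eqF. Qed.

Let k_le : k%:R <= s0 / M ^+ 4.
Proof. by rewrite /k truncn_le// divr_ge0 ?ltW// exprn_gt0. Qed.

Let k_ge : s0 / M ^+ 4 <= 2 * k%:R.
Proof.
have h : s0 / M ^+ 4 < k%:R + 1 by rewrite natr1 /k truncnS_gt.
suff : 2 <= s0 / M ^+ 4 by lra.
rewrite ler_pdivlMr ?exprn_gt0// -(ler_pM2r (exprn_gt0 3 Mpos)) s0M.
have := @Mpow1 7 isT; have := exprn_gt0 7 Mpos; have := ler_wpM2l (ltW c0) xn.
rewrite (_ : 2 * M ^+ 4 * M ^+ 3 = 2 * M ^+ 7); [lra|ring].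
Qed.

Let kM : M <= k%:R.
Proof.
suff : 2 * M <= s0 / M ^+ 4 by have := k_ge; lra.
rewrite ler_pdivlMr ?exprn_gt0// -(ler_pM2r (exprn_gt0 3 Mpos)) s0M.
have := @Mpow1 8 isT; have := exprn_gt0 8 Mpos; have := ler_wpM2l (ltW c0) xn.
rewrite (_ : 2 * M * M ^+ 4 * M ^+ 3 = 2 * M ^+ 8); [lra|ring].
Qed.

Let expT_ge4 : 4 <= expR T.
Proof. by apply: le_trans (expR_ge1Dx _); rewrite TE; have := x100; have := l0; lra. Qed.

Let n_le_expT : n%:R <= expR T.
Proof. by rewrite -[leLHS]lnK ?posrE// ler_expR TE -/l; have := x0; lra. Qed.

Lemma bad_graph_tail : bexp p s (fun G => (~~ good_graph G)%:R) <= expR (- (2 * T)).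
Proof.
have p01 : 0 <= p <= 1 by rewrite ltW.
have h1 := degree_tail n p01 Delta.
have h2 := heavy_tail n p01 k.
have h3 := edge_count_tail n p01.
have h4 := sparse_tail p01 p0 k10 (erefl d) (erefl s0) d8 ln_k1.
have T0 : 0 < T by rewrite mulr_gt0.
apply: (@le_trans _ _ (4 * expR (- (3 * T)))); last first.
  have -> : - (2 * T) = T + - (3 * T) by ring.
  by rewrite expRD ler_wpM2r ?expR_ge0.
have b1 : n%:R * expR (18 * (n%:R * p) - Delta) <= expR (- (3 * T)).
  apply: (le_trans (ler_wpM2r (expR_ge0 _) n_le_expT)).
  rewrite -expRD ler_expR -/x /Delta.
  by have : x <= T by [rewrite TE lerDl|]; lra.
have kpos : (0 < k)%N by rewrite -(ltr0n R); exact: lt_le_trans kM.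
have kR : 0 < k%:R :> R by rewrite ltr0n.
have b2 : 'C(n, k)%:R * expR (- (22 * (n%:R * p) * k%:R)) <= expR (- (3 * T)).
  have kn : (k <= n)%N.
    rewrite -(ler_nat R); apply: (le_trans k_le).
    rewrite ler_pdivrMr ?exprn_gt0// -(ler_pM2r (exprn_gt0 3 Mpos)) s0M.
    have h : 1 <= M ^+ 7 by rewrite -(expr1n _ 7) lerXn2r ?nnegrE// ltW.
    rewrite (_ : n%:R * M ^+ 4 * M ^+ 3 = n%:R * M ^+ 7); last by ring.
    have := nR; have := ler_wpM2l (ltW nR) h; have := ler_wpM2r (ltW nR) c_small.
    lra.
  apply: (le_trans (ler_wpM2r (expR_ge0 _) (binomial_le_expR R kpos kn))).
  rewrite -expRD ler_expR -/x.
  have nk0 : 0 < n%:R / k%:R :> R by rewrite divr_gt0.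
  have h : 1 + ln (n%:R / k%:R) <= x.
    apply: (@le_trans _ _ (n%:R / k%:R)).
      by have := @expR_ge1Dx R (ln (n%:R / k%:R)); rewrite lnK.
    rewrite ler_pdivrMr//.
    have : s0 <= 2 * k%:R * M ^+ 4 by rewrite -ler_pdivrMr ?exprn_gt0.
    rewrite -(ler_pM2r (exprn_gt0 3 Mpos)) s0M.
    rewrite (_ : 2 * k%:R * M ^+ 4 * M ^+ 3 = 2 * k%:R * M ^+ 7); last by ring.
    move=> hh.
    have := ler_wpM2r (ltW kR) (@Mpow1 7 isT) => h5.
    rewrite -(ler_pM2l c0); have := mulr_ge0 (ltW kR) (exprn_ge0 7 (ltW Mpos)); lra.
  have := ler_wpM2r (ltW kR) h; have := ler_wpM2l (ltW x0) kM.
  rewrite -/T; lra.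
have b3 : expR (- (p * (size s)%:R / 4)) <= expR (- (3 * T)).
  rewrite ler_expR lerN2 size_edge_seq.
  have -> : p * (n%:R * (n%:R - 1) / 2) / 4 = x * ((n%:R - 1) / 8) by rewrite /x; field.
  rewrite (_ : 3 * T = x * (3 * M)); last by rewrite /T; ring.
  rewrite ler_pM2l//; have := @Mpow0 1 isT; rewrite expr1; have := xn; have := M1; lra.
have b4 : n.+1%:R * expR (- d ^+ 2) <= expR (- (3 * T)).
  have h : n.+1%:R <= expR T * expR T.
    apply: (@le_trans _ _ (n%:R * n%:R)); last by apply: ler_pM.
    rewrite -natr1; have := ler_wpM2r (ltW nR) n2R; have := n2R; lra.
  apply: (le_trans (ler_wpM2r (expR_ge0 _) h)).
  by rewrite -!expRD ler_expR; have := d2T; lra.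
apply: (@le_trans _ _ (bexp p s (fun G => [exists i, Delta < degree R G i]%:R +
   ((k <= #|[set i | (40 * (n%:R * p) < degree R G i)%R]|)%N%:R +
   ((#|G|%:R <= p * (size s)%:R / 4)%R%:R +
    [exists S : {set 'I_n}, (#|S|%:R <= s0)%R && (d * #|S|%:R < #|inner_edges G S|%:R)%R]%:R))))).
  have union4 (q1 q2 q3 q4 : bool) : (~~ [&& ~~ q1, ~~ q2, ~~ q3 & ~~ q4])%:R <=
      q1%:R + (q2%:R + (q3%:R + q4%:R)) :> R.
    by rewrite -!natrD ler_nat; case: q1; case: q2; case: q3; case: q4.
  by apply: ler_bexp => // G _; exact: union4.
rewrite !bexpD; lra.
Qed.

(** [influence_bound] with [a ^ 2 = 1 / s0] and [eps = 1 / (B * M)].  The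
    threshold [s0] is of order [n / M ^ 3] because the ratio [Delta / lam] is of
    order [M], which forces [d] to be of order [x / M ^ 3], and [sparse_tail] allows
    [s0] of order [d * n / x]. *)
Lemma good_graph_influence (G : {set 'I_n * 'I_n}) (v : 'cV[R]_n) : G \subset s -> good_graph G ->
  (forall i, 0 <= v i 0) -> dot v v = 1 ->
  adj R G *m v = graph_norm R G *: v ->
  4 * \sum_(e in G) (v e.1 0 * v e.2 0) ^+ 2 <= CV * (p * M ^+ 4).
Proof.
move=> GE /and4P[g1 g2 g3 g4] v0 vv Gv.
set lam := graph_norm R G in Gv.
have lamx : x / 8 <= lam.
  have := @edges_le_graph_norm R n G n0 GE; rewrite -/lam.
  move: g3; rewrite -ltNge size_edge_seq => g3 h.
  have : x * (n%:R / 8) <= lam * n%:R.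
    apply: le_trans (_ : 2 * #|G|%:R <= _); last by rewrite [leRHS]mulrC.
    apply: le_trans (_ : 2 * (p * (n%:R * (n%:R - 1) / 2) / 4) <= _); last by lra.
    have := ler_wpM2l (ltW x0) n2R; rewrite /x; lra.
  by rewrite mulrCA mulrC ler_pM2r.
have lam0 : 0 < lam by apply: lt_le_trans lamx; rewrite divr_gt0.
pose a : R := Num.sqrt s0^-1.
have a2 : a ^+ 2 = s0^-1 by rewrite sqr_sqrtr// invr_ge0 ltW.
have a0 : 0 < a by rewrite sqrtr_gt0 invr_gt0.
pose eps : R := (B * M)^-1.
have eps0 : 0 < eps by rewrite invr_gt0 mulr_gt0.
have T0 : 0 < T by rewrite mulr_gt0.
have infl := @influence_bound R n G (fun i => v i 0) lam a d eps Delta D k%:R s0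
  GE lam0 a0 eps0.
apply: (le_trans (infl _ _ v0 _ _ _ _ _ _ _)).
- by rewrite mulr_ge0// ltW.
- by rewrite mulr_ge0// ltW.
- by rewrite -vv /dot; apply: eq_bigr => i _; rewrite expr2.
- move=> i; have /matrixP/(_ i 0) := Gv; rewrite !mxE => <-.
  by apply: eq_bigr.
- move=> i; rewrite leNgt; apply/negP => hi; move/negP: g1; apply.
  by apply/existsP; exists i.
- by rewrite ler_nat ltnW// ltnNge.
- by rewrite a2 mulVf// gt_eqF.
- move=> S Ss0; rewrite leNgt; apply/negP => hS; move/negP: g4; apply.
  by apply/existsP; exists S; rewrite Ss0.
- have h1 : 2 * eps * Delta = 80 * x / B.
    by rewrite /eps /Delta /T; field; rewrite !gt_eqF.
  have h2 : 80 * x / B <= x / 32.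
    by rewrite ler_pdivrMr//; have := ler_wpM2l (ltW x0) B_large; lra.
  have h3 : 2 * eps ^- 3 * d = 2 * (c * B ^+ 3) * x.
    rewrite /eps exprVn invrK exprMn (_ : _ * d = 2 * B ^+ 3 * (d * M ^+ 3)); last by ring.
    by rewrite dM; ring.
  have := ler_wpM2r (ltW x0) c1; rewrite h1 h3; lra.
have lam1 := ltW lam0.
have p320 : 0 <= 320 :> R by rewrite ler0n.
have DL : (D / lam) ^+ 4 <= E.
  have h : D / lam <= 320 by rewrite ler_pdivrMr// /D; lra.
  apply: le_trans E_large; apply: lerXn2r; rewrite ?nnegrE//.
  by apply: divr_ge0 => //; apply: mulr_ge0; [exact: ler0n|exact: ltW].
have DeL : (Delta / lam) ^+ 4 <= E * M ^+ 4.
  have h : Delta / lam <= 320 * M.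
    rewrite ler_pdivrMr// /Delta /T; have := ler_wpM2r (ltW Mpos) lamx; lra.
  apply: le_trans (ler_wpM2r (exprn_ge0 4 (ltW Mpos)) E_large).
  rewrite -exprMn; apply: lerXn2r => //; rewrite nnegrE.
    by apply: divr_ge0 => //; apply: mulr_ge0; [exact: ler0n|exact: ltW].
  by apply: mulr_ge0 => //; exact: ltW.
have e1 : (D / lam) ^+ 4 / a ^+ 2 <= E * s0.
  by rewrite a2 invrK ler_wpM2r// ltW.
have e2 : k%:R * (Delta / lam) ^+ 4 <= E * s0.
  apply: (@le_trans _ _ (s0 / M ^+ 4 * (E * M ^+ 4))).
    by apply: ler_pM => //; rewrite -[4%N]/(2 * 2)%N exprM sqr_ge0.
  by rewrite le_eqVlt; apply/orP; left; apply/eqP; field; rewrite gt_eqF.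
have a4 : a ^+ 4 = s0^-1 * s0^-1 by rewrite -a2 -exprD.
have -> : CV * (p * M ^+ 4) = 2 * Delta * (9 * a ^+ 2 + 8 * 256 * a ^+ 4 * (2 * (E * s0))).
  rewrite a4 a2 /CV /Delta /T /s0 /k1 /x; field.
  by rewrite !gt_eqF.
apply: ler_wpM2l; first by rewrite !mulr_ge0// ltW.
rewrite lerD2l; apply: ler_wpM2l; last by lra.
apply: mulr_ge0; first by apply: mulr_ge0; exact: ler0n.
exact: (exprn_ge0 4 (ltW a0)).
Qed.

(** The contribution of the bad graphs to the lower tail is at most
    [expR (- 2 * T) * (1 + n ^ 2)], which is small since
    [expR T = n * expR x]. *)
Theorem cube_concentration (t : R) : 0 <= t -> t <= 4 * (CV * (p * M ^+ 4)) * n%:R ->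
  bexp p s (fun G => (t <= `|graph_norm R G - bexp p s (@graph_norm R n)|)%R%:R) <=
  3 * expR (- (t ^+ 2 / (8 * (CV * (p * M ^+ 4))))) + expR (- (2 * x)).
Proof.
move=> t0 tv; set v := CV * (p * M ^+ 4) in tv *.
have p01 : 0 <= p <= 1 by rewrite ltW.
have v0 : 0 < v := mulr_gt0 CV0 (mulr_gt0 p0 (exprn_gt0 4 Mpos)).

have bad := bad_graph_tail.
have cert (G : {set 'I_n * 'I_n}) : G \subset s -> good_graph G ->
  exists2 al : 'I_n * 'I_n -> R, \sum_(e <- s) al e ^+ 2 <= v &
  forall G' : {set 'I_n * 'I_n}, G' \subset s ->
    graph_norm R G - \sum_(e <- s | (e \in G) != (e \in G')) al e <= graph_norm R G'.
  move=> GE gG; have [w [w0 ww] Gw] := graph_perron R G n0.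
  exists (fun e => if e \in G then 2 * (w e.1 0 * w e.2 0) else 0); last first.
    exact: graph_norm_certificate.
  apply: le_trans (good_graph_influence GE gG w0 ww Gw).
  rewrite mulr_sumr -(sum_edge_seq (fun e => 4 * (w e.1 0 * w e.2 0) ^+ 2) GE).
  by apply: ler_sum => e _; case: (e \in G); rewrite ?expr0n// exprMn -natrX.
clearbody v.
have us : uniq s by exact: enum_uniq.
have := certified_concentration p01 us v0 (@graph_norm_bounds R n) cert t0.
set Bd := bexp p s (fun G => (~~ good_graph G)%:R) in bad *.
have Bd0 : 0 <= Bd by apply: bexp_ge0.
have Tpos : 0 < T by rewrite mulr_gt0.
have hB : Bd * (1 + t / (4 * v) * n%:R) <= 2^-1.
  have h1 : t / (4 * v) <= n%:R by rewrite ler_pdivrMr ?mulr_gt0// mulrC.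
  have h2 : 1 + t / (4 * v) * n%:R <= 2 * (n%:R * n%:R).
    have := ler_wpM2r (ltW nR) h1; have := ler_wpM2r (ltW nR) n2R; have := n2R; lra.
  apply: (@le_trans _ _ (expR (- (2 * T)) * (2 * (n%:R * n%:R)))).
    apply: ler_pM => //; apply: addr_ge0 => //; apply: mulr_ge0 => //.
    by apply: divr_ge0 => //; apply: mulr_ge0 => //; exact: ltW.
  have -> : - (2 * T) = - (2 * x) + (- l + - l) by rewrite TE; ring.
  rewrite !expRD (expRN l) lnK ?posrE// (_ : _ * _ = 2 * expR (- (2 * x))); last first.
    by field; rewrite gt_eqF.
  rewrite expRN; have h3 := @expR_ge1Dx R (2 * x).
  have h4 : (expR (2 * x))^-1 <= 4^-1 by rewrite lef_pV2 ?posrE ?expR_gt0//; have := x100; lra.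
  lra.
move=> /(_ hB) /le_trans; apply; rewrite lerD2l; apply: (le_trans bad).
by rewrite ler_expR lerN2 ler_pM2l// TE lerDl.
Qed.

End CubeConcentration.

(** * Measurability of the operator norm *)

Section OpnormMeasurable.
Local Open Scope classical_set_scope.
Local Open Scope ring_scope.
Variables (R : realType) (n : nat).

Let rational_vector (k : nat) : 'cV[R]_n :=
  map_mx ratr (odflt 0 (unpickle k : option 'cV[rat]_n)).

Let probe k : 'cV[R]_n :=
  if euclidean_norm (rational_vector k) <= 1 then rational_vector k else 0.

Lemma euclidean_norm0 : euclidean_norm (0 : 'cV[R]_n) = 0.
Proof. by rewrite -(scale0r (0 : 'cV[R]_n)) euclidean_normZ normr0 mul0r. Qed.

Let probe_le1 k : euclidean_norm (probe k) <= 1.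
Proof. by rewrite /probe; case: ifP => //; rewrite euclidean_norm0 ler01. Qed.

Lemma euclidean_norm_sup (x : 'cV[R]_n) (eta : R) : 0 <= eta ->
  (forall i, `|x i 0| <= eta) -> euclidean_norm x <= n%:R * eta.
Proof.
move=> eta0 xe; case: (posnP n) => [n0|n0].
  rewrite /euclidean_norm big1 ?sqrtr0 ?mulr_ge0// => i _.
  by have := ltn_ord i; rewrite [X in (_ < X)%N -> _]n0.
rewrite -[leRHS]ger0_norm ?mulr_ge0// -sqrtr_sqr; apply: ler_wsqrtr.
apply: (@le_trans _ _ (\sum_(i < n) eta ^+ 2)).
  apply: ler_sum => i _; rewrite -real_normK ?num_real// lerXn2r ?nnegrE//.
rewrite sumr_const card_ord -[leLHS]mulr_natl exprMn ler_wpM2r ?sqr_ge0//.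
by rewrite -natrX ler_nat -[X in (X <= _)%N]expn1 leq_pexp2l.
Qed.

Lemma rational_dense (x : 'cV[R]_n) (eta : R) : 0 < eta ->
  exists y : 'cV[rat]_n, euclidean_norm (x - map_mx ratr y) <= n%:R * eta.
Proof.
move=> eta0.
have h i : {q : rat | `|x i 0 - ratr q| <= eta}.
  apply: cid; have [|q] := @rat_in_itvoo R (x i 0 - eta) (x i 0 + eta).
    by rewrite ltrD2l gtrN.
  rewrite in_itv/= => /andP[h1 h2]; exists q; rewrite ler_norml; lra.
exists (\col_i sval (h i)); apply: euclidean_norm_sup; first exact: ltW.
by move=> i; rewrite !mxE; exact: (svalP (h i)).
Qed.

(** The supremum may be taken over the rational vectors of the unit ball.  A
    rational vector close to a unit vector may lie outside the ball, whence the
    rescaling by [1 + q]. *)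
Lemma opnorm_probe (M : 'M[R]_n) :
  opnorm M = sups (fun k => euclidean_norm (M *m probe k)) 0%N.
Proof.
rewrite /sups/=; set U := sdrop _ _.
have UE k : U (euclidean_norm (M *m probe k)) by exists k.
have Uub : has_sup U.
  split; first by exists (euclidean_norm (M *m probe 0)).
  by exists (opnorm M) => _ [k _ <-]; exact: opnorm_ub.
set S := sup U.
have hS k : euclidean_norm (M *m probe k) <= S by exact: sup_upper_bound.
apply/eqP; rewrite eq_le; apply/andP; split; last first.
  by apply: sup_le_ub; [case: Uub|move=> _ [k _ <-]; exact: opnorm_ub].
have S0 : 0 <= S by apply: le_trans (hS 0%N); exact: euclidean_norm_ge0.
have unit_ball (y : 'cV[rat]_n) : euclidean_norm (map_mx (ratr : rat -> R) y) <= 1 ->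
    euclidean_norm (M *m map_mx ratr y) <= S.
  move=> y1; have := hS (pickle y); rewrite /probe /rational_vector pickleK /=.
  by rewrite y1.
have ball (y : 'cV[rat]_n) (r : rat) : 0 < r -> euclidean_norm (map_mx (ratr : rat -> R) y) <= ratr r ->
    euclidean_norm (M *m map_mx ratr y) <= S * ratr r.
  move=> r0 yr; have rR : 0 < ratr r :> R by rewrite ltr0q.
  have e : map_mx (ratr : rat -> R) (r^-1 *: y) = (ratr r)^-1 *: map_mx ratr y.
    by apply/matrixP => i j; rewrite !mxE rmorphM/= fmorphV.
  have ri : 0 <= (ratr r)^-1 :> R by rewrite invr_ge0 ltW.
  have := unit_ball (r^-1 *: y); rewrite e -scalemxAr !euclidean_normZ (ger0_norm ri).
  by rewrite !ler_pdivrMl// mulr1 mulrC => /(_ yr).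
set F := Num.sqrt (\sum_i \sum_j M i j ^+ 2).
have F0 : 0 <= F by exact: sqrtr_ge0.
apply: opnorm_le => x x1; apply/ler_addgt0Pr => e e0.
pose K := S + F + 1.
have K0 : 0 < K by rewrite ltr_wpDl// addr_ge0.
have [q] := @rat_in_itvoo R 0 (e / K) (divr_gt0 e0 K0).
rewrite in_itv/= => /andP[q0 qe].
have N0 : 0 < n.+1%:R :> R by rewrite ltr0Sn.
have [y hy] := rational_dense x (divr_gt0 q0 N0).
have hy' : euclidean_norm (x - map_mx (ratr : rat -> R) y) <= ratr q.
  apply: (le_trans hy); rewrite mulrCA -[leRHS]mulr1 ler_pM2l// ler_pdivrMr// mul1r.
  by rewrite ler_nat.
set z := map_mx _ y in hy'.
have zN : euclidean_norm z <= ratr (1 + q).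
  rewrite rmorphD rmorph1 -(subrK x z); apply: (le_trans (euclidean_normD _ _)).
  rewrite addrC lerD// -opprB -scaleN1r euclidean_normZ normrN1 mul1r//.
have Mz := ball y (1 + q) (_ : 0 < 1 + q) zN.
have {}Mz : euclidean_norm (M *m z) <= S * (1 + ratr q).
  by have := Mz; rewrite rmorphD rmorph1; apply; rewrite addr_gt0//; move: q0; rewrite ltr0q.
have Md := mulmx_norm_le M (x - z).
have := euclidean_normD (M *m z) (M *m (x - z)).
rewrite -mulmxDr addrC subrK => /le_trans; apply.
have h1 := ler_wpM2l F0 hy'; rewrite -/F in Md.
have h2 : ratr q * K <= e by rewrite -ler_pdivlMr// ltW.
have := ltW q0; rewrite /K in h2; lra.
Qed.

Lemma measurable_opnorm d (T : measurableType d) (A : T -> 'M[R]_n) :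
  (forall i j, measurable_fun [set: T] (fun w => A w i j)) ->
  measurable_fun [set: T] (fun w => opnorm (A w)).
Proof.
move=> mA; under eq_fun do rewrite opnorm_probe.
apply: (measurable_realfun.measurable_fun_sups (h := fun k w => euclidean_norm (A w *m probe k))).
  by move=> w _; exists (opnorm (A w)) => _ [k _ <-]; exact: opnorm_ub.
move=> k.
rewrite (_ : (fun w => _) = @Num.sqrt R \o (fun w => \sum_i (A w *m probe k) i 0 ^+ 2))//.
apply: measurableT_comp.
  by apply: continuous_measurable_fun; exact: realfun.sqrt_continuous.
apply: measurable_sum => i; apply: measurable_funX.
under eq_fun do rewrite mxE.
by apply: measurable_sum => j; apply: measurable_funM => //; exact: measurable_cst.
Qed.

End OpnormMeasurable.

(** * From the probability space to the cube *)

Section BexpSum.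
Variables (R : realType) (T : finType) (p : R).

(** The recursive expectation is the one of the product Bernoulli measure. *)
Lemma bexp_sumE (s : seq T) (f : {set T} -> R) : uniq s ->
  bexp p s f = \sum_(G : {set T} | G \subset s)
    (\prod_(e <- s) (if e \in G then p else 1 - p)) * f G.
Proof.
elim: s f => [|e s IH] f /=.
  move=> _; rewrite (big_pred1 finset.set0) ?big_nil ?mul1r// => G.
  apply/fintype.subsetP/eqP => [h|-> x]; last by rewrite finset.in_set0.
  by apply/setP => x; rewrite finset.in_set0; apply/negP => /h.
move=> /andP[es us]; rewrite !IH// [RHS](bigID (fun G : {set T} => e \in G))/= [RHS]addrC.
have prodE (G : {set T}) : \prod_(i <- s) (if i \in e |: G then p else 1 - p) =
   \prod_(i <- s) (if i \in G then p else 1 - p).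
  rewrite big_seq [RHS]big_seq; apply: eq_bigr => i si.
  by rewrite finset.in_setU1 (_ : (i == e) = false)//; apply: contraNF es => /eqP <-.
congr (_ + _); last first.
- rewrite mulr_sumr [RHS](reindex_onto (fun G => e |: G) (fun G => G :\ e))/=; last first.
    by move=> G /andP[_ eG]; rewrite finset.setD1K.
  apply: eq_big => [G|G Gs].
    rewrite finset.setU11 andbT; apply/idP/andP => [Gs|[Gs /eqP GE]].
      by split; [exact: subsetU1_cons|rewrite setU1K// (subset_notin es Gs)].
    have eG : e \notin G by rewrite -GE !inE eqxx.
    apply/fintype.subsetP => i iG; have : i \in e :: s.
      by apply: (fintype.subsetP Gs); rewrite finset.in_setU1 iG orbT.
    by rewrite inE => /orP[/eqP ie|//]; rewrite -ie iG in eG.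
  by rewrite big_cons finset.setU11 prodE mulrA.
- rewrite mulr_sumr; apply: eq_big => [G|G Gs].
    apply/idP/andP => [Gs|[/fintype.subsetP Gs eG]].
      by split; [exact: subset_cons|exact: subset_notin Gs].
    apply/fintype.subsetP => i iG; have := Gs _ iG.
    by rewrite inE => /orP[/eqP ie|//]; rewrite -ie iG in eG.
  by rewrite big_cons (negPf (subset_notin es Gs)) mulrA.
Qed.

End BexpSum.

Section ErdosRenyiLaw.
Local Open Scope classical_set_scope.
Local Open Scope ring_scope.
Variables (R : realType) (n : nat) (p : R).
Variables (d : measure_display) (T : measurableType d) (P : probability T R).
Variable A : T -> 'M[R]_n.
Hypotheses (p01 : 0 <= p <= 1) (hA : erdos_renyi_adjacency P p A).
Let s := edge_seq n.

Let value_set (G : {set 'I_n * 'I_n}) (e : 'I_n * 'I_n) : set R :=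
  if e \in G then [set 1] else [set 0].

Let cell (G : {set 'I_n * 'I_n}) : set T :=
  \bigcap_(e in [set` [set e : 'I_n * 'I_n | (e.1 < e.2)%N]%SET])
    ((fun w => A w e.1 e.2) @^-1` value_set G e).

Let cellP G w : cell G w <-> forall e : 'I_n * 'I_n, (e.1 < e.2)%N -> A w e.1 e.2 = (e \in G)%:R.
Proof.
split=> [h e lte|h e /=].
  have := h e; rewrite /= inE => /(_ lte).
  by rewrite /value_set; case: (e \in G).
by rewrite inE => /h; rewrite /value_set /preimage /=; case: (e \in G).
Qed.

Let cell_adj (G : {set 'I_n * 'I_n}) w : G \subset s -> cell G w -> A w = adj R G.
Proof.
move=> /fintype.subsetP GE /cellP h; apply/matrixP => i j; rewrite mxE.
have [ij|ji|/val_inj <-] := ltngtP i j.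
- rewrite (h (i, j) ij); congr (_%:R); case: (boolP ((j, i) \in G)) => [/GE|_]; last by rewrite orbF.
  by rewrite mem_edge_seq /= => /(ltn_trans ij); rewrite ltnn.
- rewrite -(er_symmetric hA w) mxE (h (j, i) ji); congr (_%:R).
  case: (boolP ((i, j) \in G)) => [/GE|_] //.
  by rewrite mem_edge_seq /= => /(ltn_trans ji); rewrite ltnn.
- rewrite (er_diagonal hA) orbb; case: (boolP ((i, i) \in G)) => // /GE.
  by rewrite mem_edge_seq ltnn.
Qed.

Let measurable_value G e : measurable (value_set G e).
Proof. by rewrite /value_set; case: ifP. Qed.

Let measurable_cell G : measurable (cell G).
Proof.
apply: fin_bigcap_measurable; first exact: finite_finset.
move=> e /=; rewrite inE => lte; rewrite -[X in measurable X]setTI.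
by apply: (er_measurable hA).
Qed.

Let prob_cell G : P (cell G) = (\prod_(e <- s) (if e \in G then p else 1 - p))%:E.
Proof.
rewrite (er_independent hA); first last.
- by move=> e; exact: measurable_value.
- by move=> e; rewrite inE.
have -> : \prod_(e <- s) (if e \in G then p else 1 - p) =
    \prod_(e in [set e : 'I_n * 'I_n | (e.1 < e.2)%N]%SET) (if e \in G then p else 1 - p).
  rewrite /s /edge_seq big_enum_cond/=; apply: eq_bigl => e.
  by rewrite !inE andbT.
rewrite -prodEFin; apply: eq_bigr => e; rewrite inE => lte.
rewrite (er_bernoulli hA lte)// bernoulli_probE// /value_set.
case: (e \in G).
  by rewrite !diracE mem_set//= memNset/= ?mule1 ?mule0 ?adde0// => /eqP; rewrite eq_sym oner_eq0.
rewrite !diracE memNset/= ?mem_set//= ?mule1 ?mule0 ?add0e//.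
by move/eqP; rewrite oner_eq0.
Qed.

Let graphs : seq {set 'I_n * 'I_n} :=
  seq.filter (fun G : {set 'I_n * 'I_n} => G \subset s) (index_enum _).
Let good_part : set T := \big[setU/set0]_(G <- graphs) cell G.

Let cell_disjoint : trivIset [set` graphs] cell.
Proof.
move=> G H /=; rewrite !mem_filter => /andP[/fintype.subsetP GE _] /andP[/fintype.subsetP HE _].
move=> [w [/cellP hG /cellP hH]]; apply/setP => e.
case: (boolP (e.1 < e.2)%N) => lte; last first.
  apply/idP/idP => [/GE|/HE]; by rewrite mem_edge_seq (negPf lte).
have := hG e lte; rewrite (hH e lte).
by case: (e \in G); case: (e \in H) => // /eqP; rewrite ?oner_eq0// eq_sym oner_eq0.
Qed.

Let uniq_graphs : uniq graphs.
Proof. by rewrite filter_uniq// index_enum_uniq. Qed.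

Let measurable_good_part : measurable good_part.
Proof. by apply: bigsetU_measurable => G _; exact: measurable_cell. Qed.

Let graphs_bexp (f : {set 'I_n * 'I_n} -> R) :
  (\sum_(G <- graphs) (f G)%:E * P (cell G))%E = (bexp p s f)%:E.
Proof.
rewrite bexp_sumE ?enum_uniq// big_filter -sumEFin; apply: eq_bigr => G _.
by rewrite prob_cell -EFinM mulrC.
Qed.

Let prob_good_part : P good_part = 1%E.
Proof.
have := graphs_bexp (fun=> 1); rewrite bexp_cst => <-.
rewrite -[P good_part]mul1e -integral_cst// /good_part ge0_integral_bigsetU//.
by apply: eq_bigr => G _; rewrite integral_cst.
Qed.

(** The events that the matrix is the adjacency matrix of a given graph are
    disjoint and have total probability 1; the entries may take other values on
    the remaining null set, where only the measurability of [Y] matters. *)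
Theorem erdos_renyi_expectation (Y : T -> R) (f : {set 'I_n * 'I_n} -> R) :
  measurable_fun [set: T] Y -> (forall w, 0 <= Y w) ->
  (forall (G : {set 'I_n * 'I_n}) w, G \subset s -> A w = adj R G -> Y w = f G) ->
  (\int[P]_w (Y w)%:E)%E = (bexp p s f)%:E.
Proof.
move=> mY Y0 YE; have mYE : measurable_fun [set: T] ((fun w => (Y w)%:E) : T -> \bar R) by apply/measurable_EFinP.
have Y0E w : setT w -> (0 <= (Y w)%:E)%E by rewrite lee_fin.
have N0 : P (~` good_part) = 0%E by rewrite probability_setC// prob_good_part subee.
rewrite (ge0_negligible_integral (measurableC measurable_good_part) measurableT mYE Y0E N0).
rewrite setTD setCK /good_part ge0_integral_bigsetU//; last 2 first.
- by apply: measurable_funS mYE => //; exact: subsetT.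
- by move=> w _; rewrite lee_fin.
rewrite -graphs_bexp big_seq [RHS]big_seq; apply: eq_bigr => G.
rewrite mem_filter => /andP[Gs _].
rewrite -integral_cst//; apply: eq_integral => w /set_mem wG.
by rewrite (YE G)//; exact: cell_adj.
Qed.

End ErdosRenyiLaw.

(** * Asymptotic consequences of the density condition *)

Section Asymptotics.
Variable R : realType.

Lemma ln_ln_gt0 (n : nat) : (3 <= n)%N -> 0 < ln (ln n%:R) :> R.
Proof.
move=> n3; apply: ln_gt0.
have e3 : expR 1 < n%:R :> R by apply: (lt_le_trans (expR1_lt3 R)); rewrite (ler_nat _ 3).
by rewrite -[ltLHS](expRK 1) ltr_ln ?posrE ?expR_gt0//; apply: lt_trans e3; exact: expR_gt0.
Qed.

(** The power [m + 1] of [1 + y <= expR y] at [y = x / (m + 1)]. *)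
Lemma power_le_expR (x : R) (m : nat) : 0 <= x ->
  (1 + x) ^+ m.+1 <= m.+1%:R ^+ m.+1 * expR x.
Proof.
move=> x0; have m0 : 0 < m.+1%:R :> R by rewrite ltr0Sn.
have -> : expR x = expR (x / m.+1%:R) ^+ m.+1.
  by rewrite -expRM_natl mulrCA mulfV ?mulr1// gt_eqF.
rewrite -exprMn lerXn2r ?nnegrE ?mulr_ge0 ?addr_ge0 ?expR_ge0//.
apply: (@le_trans _ _ (m.+1%:R * (1 + x / m.+1%:R))); last first.
  by rewrite ler_pM2l// expR_ge1Dx.
rewrite mulrDr mulr1 mulrCA mulfV ?gt_eqF// mulr1 lerD2r.
by rewrite ler1n.
Qed.

(** With [lam = ln (ln n)], the hypothesis on [p] reads [ln n <= n * p * lam].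
    Hence the left-hand side is at most [K * (1 + lam) ^ 9], whereas [n * p] is
    at least [expR lam / lam], which is larger than every power of [lam]. *)
Lemma density_dominates_sparsity (K : R) : 0 < K -> exists2 N : R, 0 < N &
  forall (n : nat) (p : R), (3 <= n)%N -> N <= n%:R -> 0 < p ->
    ln n%:R / (n%:R * ln (ln n%:R)) <= p ->
    K * (1 + ln n%:R / (n%:R * p)) ^+ 9 <= n%:R * p.
Proof.
move=> K0; pose Q : R := 11 ^+ 11.
have Q0 : 0 < Q by apply: exprn_gt0; exact: ltr0Sn.
exists (expR (expR (Q * K))) => [|n p n3 Nn p0 hp]; first exact: expR_gt0.
have nR : 0 < n%:R :> R by rewrite ltr0n (leq_trans _ n3).
have lnN : expR (Q * K) <= ln n%:R.
  by rewrite -(expRK (expR _)) ler_ln ?posrE ?expR_gt0.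
have l0 : 0 < ln n%:R :> R by apply: lt_le_trans lnN; exact: expR_gt0.
have lamN : Q * K <= ln (ln n%:R).
  by rewrite -(expRK (Q * K)) ler_ln ?posrE ?expR_gt0.
have e : expR (ln (ln n%:R)) = ln n%:R :> R by rewrite lnK.
have := ln_ln_gt0 n3; set lam := ln (ln n%:R) in lamN hp e * => lam0.
have x0 : 0 < n%:R * p by rewrite mulr_gt0.
set x := n%:R * p in x0 *.
have lx : ln n%:R <= x * lam.
  move: hp; rewrite ler_pdivrMr ?mulr_gt0// /x => h.
  by rewrite (_ : n%:R * p * lam = p * (n%:R * lam)) //; ring.
have M1 : 1 + ln n%:R / x <= 1 + lam by rewrite lerD2l ler_pdivrMr// mulrC.
have lx0 : 0 <= ln n%:R / x by rewrite divr_ge0// ltW.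
have M9 : (1 + ln n%:R / x) ^+ 9 <= (1 + lam) ^+ 9.
  by apply: lerXn2r => //; rewrite nnegrE addr_ge0// ltW.
apply: (le_trans (ler_wpM2l (ltW K0) M9)).
have P9 : 0 < (1 + lam) ^+ 9 by rewrite exprn_gt0// addr_gt0.
have h11 := @power_le_expR lam 10 (ltW lam0); rewrite -/Q e in h11.
have h2 : (1 + lam) ^+ 11 <= Q * x * (1 + lam).
  apply: (le_trans h11); rewrite -mulrA ler_pM2l//; apply: (le_trans lx).
  by rewrite ler_pM2l//; lra.
have h3 : (1 + lam) ^+ 10 <= Q * x.
  by rewrite -(@ler_pM2r _ (1 + lam)) ?addr_gt0// -exprSr.
rewrite -(ler_pM2l Q0); apply: le_trans h3.
by rewrite [leRHS]exprS mulrA ler_pM2r//; lra.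
Qed.

End Asymptotics.

(** * Deviation probabilities as expectations on the cube *)

Section MainBound.
Local Open Scope classical_set_scope.
Local Open Scope ring_scope.
Variables (R : realType) (n : nat) (p : R).
Variables (d : measure_display) (T : measurableType d) (P : probability T R).
Variable A : T -> 'M[R]_n.
Hypotheses (p01 : 0 <= p <= 1) (hA : erdos_renyi_adjacency P p A).
Let s := edge_seq n.
Let Z w := opnorm (A w).

Let mZ : measurable_fun [set: T] Z.
Proof.
apply: measurable_opnorm => i j; have [ij|ji|/val_inj <-] := ltngtP i j.
- exact: (er_measurable hA).
- rewrite (_ : (fun w => _) = (fun w => A w j i)); first exact: (er_measurable hA).
  by apply/funext => w; rewrite -{1}(er_symmetric hA w) mxE.
- rewrite (_ : (fun w => _) = cst 0); first exact: measurable_cst.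
  by apply/funext => w; exact: (er_diagonal hA).
Qed.

Lemma expectation_opnorm : ('E_P[Z])%E = (bexp p s (@graph_norm R n))%:E.
Proof.
rewrite unlock; apply: (erdos_renyi_expectation p01 hA mZ).
  by move=> w; exact: opnorm_ge0.
by move=> G w _ AG; rewrite /Z AG.
Qed.

Let event mu t : set T := [set w | (t <= `|Z w - mu|)%R].

Lemma measurable_deviation mu t : measurable (event mu t).
Proof.
have m : measurable_fun [set: T] (fun w => `|Z w - mu|).
  apply: measurableT_comp; first exact: normr_measurable.
  by apply: measurable_funB => //; exact: measurable_cst.
rewrite (_ : event mu t = [set: T] `&` (fun w => `|Z w - mu|) @^-1` `[t, +oo[%classic).
  by apply: m => //; exact: measurable_itv.
by apply/seteqP; split => w /=; rewrite in_itv/= andbT// => -[].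
Qed.

(** [erdos_renyi_expectation] for the indicator of the event. *)
Lemma prob_deviation mu t :
  P (event mu t) = (bexp p s (fun G => (t <= `|graph_norm R G - mu|)%R%:R))%:E.
Proof.
have mE := measurable_deviation mu t.
rewrite -(@erdos_renyi_expectation _ _ _ _ _ P A p01 hA (\1_(event mu t)) _).
- by rewrite integral_indic// setIT.
- exact: measurable_indic.
- by move=> w; rewrite indicE.
- move=> G w _ AG; rewrite indicE.
  rewrite (_ : (w \in event mu t) = (t <= `|graph_norm R G - mu|)%R)//.
  by apply/idP/idP => [/set_mem|h]; [|apply/mem_set]; rewrite /event/= /Z AG.
Qed.

End MainBound.

(** * Absorbing the constants *)

Section FinalArithmetic.
Variable R : realType.

(** The bound 1 covers [y <= 4]; beyond that, dividing the exponent by 4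
    absorbs the factor 4. *)
Lemma absorb_constant (q y : R) : q <= 1 -> q <= 4 * expR (- y) ->
  q <= expR (1 - y / 4).
Proof.
move=> q1 qy; have [y4|y4] := leP y 4.
  by apply: (le_trans q1); rewrite -[leLHS]expR0 ler_expR; lra.
apply: (le_trans qy).
have h : 4 <= expR (1 + 3 * y / 4) :> R by apply: le_trans (expR_ge1Dx _); lra.
have -> : 1 - y / 4 = (1 + 3 * y / 4) + - y by field.
by rewrite expRD ler_wpM2r ?expR_ge0.
Qed.

Lemma er_sigma_gt0 n (p : R) : 0 < p -> 0 < er_sigma n p.
Proof.
move=> p0; rewrite /er_sigma mulr_gt0 ?sqrtr_gt0// ltr_pwDl// divr_ge0 ?sqr_ge0//.
Qed.

Lemma sqr_er_sigma n (p : R) : 0 <= p ->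
  er_sigma n p ^+ 2 = p * (1 + (ln n%:R / (n%:R * p)) ^+ 2) ^+ 2.
Proof. by move=> p0; rewrite /er_sigma exprMn sqr_sqrtr// expr_div_n. Qed.

End FinalArithmetic.

Section Tail.
Local Open Scope classical_set_scope.
Local Open Scope ring_scope.
Variables (R : realType) (n : nat) (p c B E : R).
Variables (d : measure_display) (T : measurableType d) (P : probability T R).
Variable A : T -> 'M[R]_n.
Let x : R := n%:R * p.
Let M : R := 1 + ln n%:R / x.
Let CV : R := 80 * 27 / c * (9 + 16 * 256 * E).
Hypotheses (n2 : (2 <= n)%N) (p0 : 0 < p) (p1 : p <= 1).
Hypotheses (c0 : 0 < c) (B_large : 40 * 64 <= B) (E_large : 320 ^+ 4 <= E)
  (c1 : c * (64 * B ^+ 3) <= 1).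
Hypothesis Mx : 100 / c ^+ 2 * M ^+ 9 <= x.
Hypothesis CV1 : 1 <= CV.
Hypothesis hA : erdos_renyi_adjacency P p A.
Let Z w := opnorm (A w).
Let sigma := er_sigma n p.

(** The variance proxy [CV * p * M ^ 4] of [cube_concentration] is at most
    [4 * CV * sigma ^ 2], because [M ^ 2 <= 2 * (1 + (M - 1) ^ 2)].  In the range
    of [t] considered, [expR (- (2 * x))] is smaller than the Gaussian term. *)
Theorem opnorm_deviation_dense (t : R) : 0 <= t -> t <= sigma * Num.sqrt x ->
  (P [set w | (t <= `|Z w - fine ('E_P[Z])|)%R] <=
     (expR (1 - t ^+ 2 / (4 * (32 * CV) * sigma ^+ 2))%R)%:E)%E.
Proof.
move=> t0 ht; have p01 : 0 <= p <= 1 by rewrite ltW.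
have nR : 0 < n%:R :> R by rewrite ltr0n (leq_trans _ n2).
have x0 : 0 < x by rewrite mulr_gt0.
have s0 : 0 < sigma by exact: er_sigma_gt0.
have s2 : 0 < sigma ^+ 2 by rewrite exprn_gt0.
have CV0 : 0 < CV by apply: lt_le_trans CV1.
have n1R : 1 <= n%:R :> R by rewrite ler1n (leq_trans _ n2).
pose D := ln n%:R / x; have ME : M = 1 + D by [].
have D0 : 0 <= D by rewrite divr_ge0 ?ln_ge0// ltW.
have M1 : 1 <= M by rewrite ME lerDl.
have sE : sigma ^+ 2 = p * (1 + D ^+ 2) ^+ 2 by rewrite /sigma sqr_er_sigma// ltW.
have M2 : M ^+ 2 <= 2 * (1 + D ^+ 2) by rewrite ME; have := sqr_ge0 (1 - D); lra.
have M4 : p * M ^+ 4 <= 4 * sigma ^+ 2.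
  have : (M ^+ 2) ^+ 2 <= (2 * (1 + D ^+ 2)) ^+ 2.
    by apply: lerXn2r => //; rewrite nnegrE ?sqr_ge0// mulr_ge0// addr_ge0 ?sqr_ge0.
  rewrite -exprM => /(ler_wpM2l (ltW p0)); rewrite sE; lra.
have s_le : sigma ^+ 2 <= p * M ^+ 4.
  rewrite sE; apply: ler_wpM2l; first exact: ltW.
  rewrite (exprM M 2 2); apply: lerXn2r; rewrite ?nnegrE ?sqr_ge0 ?addr_ge0 ?sqr_ge0//.
  by rewrite ME sqrrD expr1n; lra.
have M0 : 0 < M := lt_le_trans ltr01 M1.
have pM0 : 0 < p * M ^+ 4 := mulr_gt0 p0 (exprn_gt0 4 M0).
pose v := CV * (p * M ^+ 4).
have v0 : 0 < v := mulr_gt0 CV0 pM0.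
have hv : p * M ^+ 4 <= v by rewrite /v -[leLHS]mul1r ler_pM2r.
have t2 : t ^+ 2 <= sigma ^+ 2 * x.
  rewrite -(sqr_sqrtr (ltW x0)) -exprMn; apply: lerXn2r => //.
  by rewrite nnegrE mulr_ge0 ?sqrtr_ge0// ltW.
have tv : t <= 4 * v * n%:R.
  have q0 : 0 <= 4 * v * n%:R.
    by apply: mulr_ge0 => //; apply: mulr_ge0 => //; exact: ltW.
  rewrite -(@ler_pXn2r _ 2)// ?nnegrE//.
  have hx : x <= n%:R * (p * M ^+ 4).
    rewrite /x ler_pM2l// -[leLHS]mulr1 ler_pM2l//.
    by rewrite -(expr1n _ 4) lerXn2r ?nnegrE// ltW.
  apply: (le_trans t2); apply: (@le_trans _ _ (v * (n%:R * v))).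
    apply: ler_pM; [exact: ltW|exact: ltW|exact: le_trans hv|].
    by apply: (le_trans hx); rewrite ler_pM2l.
  have vn := mulr_ge0 (mulr_ge0 (ltW v0) (ltW v0)) (ltW nR).
  have h := ler_wpM2l vn n1R; lra.
have conc := cube_concentration n2 p0 p1 c0 B_large E_large c1 Mx t0 tv.
rewrite (expectation_opnorm p01 hA) /= (prob_deviation p01 hA) lee_fin.
set y := t ^+ 2 / (32 * CV * sigma ^+ 2).
have -> : t ^+ 2 / (4 * (32 * CV) * sigma ^+ 2) = y / 4.
  by rewrite /y; field; rewrite !gt_eqF.
apply: absorb_constant.
  rewrite -[leRHS](bexp_cst p (edge_seq n) 1); apply: ler_bexp => // G _.
  by case: (t <= _); rewrite ?lexx ?ler01.
have W0 : 0 < 32 * CV * sigma ^+ 2 := mulr_gt0 (mulr_gt0 (ltr0Sn _ 31) CV0) s2.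
have y1 : y <= t ^+ 2 / (8 * v).
  have v8 : 0 < 8 * v := mulr_gt0 (ltr0Sn _ 7) v0.
  apply: ler_wpM2l; first exact: sqr_ge0.
  rewrite lef_pV2 ?posrE//.
  by have := ler_wpM2l (ltW CV0) M4; rewrite /v; lra.
have y2 : y <= 2 * x.
  rewrite /y ler_pdivrMr//; apply: (le_trans t2).
  have := ler_wpM2l (mulr_ge0 (ltW s2) (ltW x0)) CV1.
  have := mulr_ge0 (ltW s2) (ltW x0); lra.
have e1 : expR (- (t ^+ 2 / (8 * v))) <= expR (- y) by rewrite ler_expR lerN2.
have e2 : expR (- (2 * x)) <= expR (- y) by rewrite ler_expR lerN2.
apply: (le_trans conc); rewrite -/x -/D -/M -/v; lra.
Qed.

End Tail.

Local Open Scope classical_set_scope.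
Local Open Scope ring_scope.

Theorem theorem4p7 (R : realType) :
  exists C0 C1 C2 : R, [/\ 0 < C0, 0 < C1, 0 < C2 &
  forall (n : nat) (p : R), (3 <= n)%N ->
    C0 * ln n%:R / (n%:R * ln (ln n%:R)) <= p -> p <= 1 / 2 ->
  forall (d : measure_display) (T : measurableType d) (P : probability T R)
    (A : T -> 'M[R]_n), erdos_renyi_adjacency P p A ->
  let Z : T -> R := fun w => opnorm (A w) in
  let sigma := er_sigma n p in
  forall t : R, 0 <= t ->
    t <= C2 * sigma * Num.sqrt (n%:R * p) *
         Num.min 1 (Num.sqrt (ln (n%:R * p) / ln (1 / p))) ->
  (P [set w | (t <= `|Z w - fine ('E_P[Z])|)%R] <=
     (expR (1 - t ^+ 2 / (C1 * sigma ^+ 2))%R)%:E)%E].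
Proof.
pose B : R := 40 * 64; pose E : R := 320 ^+ 4.
have B_large : 40 * 64 <= B by exact: lexx.
have E_large : 320 ^+ 4 <= E by exact: lexx.
have B0 : 0 < B by apply: mulr_gt0; exact: ltr0Sn.
have E0 : 0 < E by apply: exprn_gt0; exact: ltr0Sn.
clearbody B E.
pose c : R := (64 * B ^+ 3)^-1.
have B3 : 0 < 64 * B ^+ 3 by apply: mulr_gt0; [exact: ltr0Sn|exact: exprn_gt0].
have c0 : 0 < c by rewrite invr_gt0.
have c1 : c * (64 * B ^+ 3) <= 1 by rewrite mulVf// gt_eqF.
have cle : c <= 80 * 27.
  have B1 : 1 <= B ^+ 3 by apply: exprn_ege1; lra.
  have := ler_wpM2l (ltW c0) B1; lra.
clearbody c.
pose CV : R := 80 * 27 / c * (9 + 16 * 256 * E).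
have CV1 : 1 <= CV.
  apply: mulr_ege1; first by rewrite ler_pdivlMr// mul1r.
  have := ltW E0; lra.
have CV0 : 0 < CV by apply: lt_le_trans CV1.
have [N N0 hN] := @density_dominates_sparsity R (100 / c ^+ 2) (divr_gt0 (ltr0Sn _ _) (exprn_gt0 2 c0)).
(* The factor [(1 + N)^-1] makes [t <= sigma] for [n < N], where the right-hand
   side is then at least 1. *)
exists 1, (4 * (32 * CV)), (1 + N)^-1; split => //.
- exact: (mulr_gt0 (ltr0Sn _ 3) (mulr_gt0 (ltr0Sn _ 31) CV0)).
- by rewrite invr_gt0 addr_gt0.
move=> n p n3; rewrite mul1r => hp hp2 d T P A hA Z sigma t t0 ht.
have nR : 0 < n%:R :> R by rewrite ltr0n (leq_trans _ n3).
have p0 : 0 < p.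
  apply: lt_le_trans hp; have h := ln_ln_gt0 R n3.
  apply: divr_gt0; last exact: mulr_gt0.
  apply: ln_gt0; by rewrite ltr1n (leq_trans _ n3).
have x0 : 0 < n%:R * p by rewrite mulr_gt0.
have s0 : 0 < sigma by exact: er_sigma_gt0.
have C21 : (1 + N)^-1 <= 1 by rewrite invf_le1 ?addr_gt0// lerDl ltW.
have C20 : 0 <= (1 + N)^-1 by rewrite invr_ge0 addr_ge0// ltW.
have {}ht : t <= (1 + N)^-1 * (sigma * Num.sqrt (n%:R * p)).
  apply: (le_trans ht); rewrite [leRHS]mulrA -[leRHS]mulr1. apply: ler_wpM2l.
    by apply: mulr_ge0; [apply: mulr_ge0 => //; exact: ltW|exact: sqrtr_ge0].
  by rewrite ge_min lexx.
have p01 : 0 <= p <= 1 by rewrite ltW//; lra.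
have [Nn|nN] := leP N n%:R.
  apply: (opnorm_deviation_dense _ p0 _ c0 B_large E_large c1) => //.
  - exact: leq_trans n3.
  - lra.
  - exact: hN.
  - apply: (le_trans ht); rewrite -[leRHS]mul1r ler_wpM2r//.
    by rewrite mulr_ge0 ?sqrtr_ge0// ltW.
apply: (@le_trans _ _ 1%E).
  by apply: probability_le1; exact: (measurable_deviation hA).
rewrite lee_fin -[leLHS]expR0 ler_expR subr_ge0 ler_pdivrMr ?mul1r; last first.
  exact: (mulr_gt0 (mulr_gt0 (ltr0Sn _ 3) (mulr_gt0 (ltr0Sn _ 31) CV0)) (exprn_gt0 2 s0)).
have t2 : t ^+ 2 <= ((1 + N)^-1 * (sigma * Num.sqrt (n%:R * p))) ^+ 2.
  by apply: lerXn2r => //; rewrite nnegrE (le_trans t0).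
apply: (le_trans t2); rewrite (exprMn 2 (1 + N)^-1) (exprMn 2 sigma) sqr_sqrtr ?(ltW x0)//.
have xN : n%:R * p <= 1 + N.
  have : n%:R * p <= n%:R * 1 by rewrite ler_wpM2l// ; lra.
  lra.
have h1 : (1 + N)^-1 ^+ 2 * (n%:R * p) <= 1.
  rewrite exprVn mulrC ler_pdivrMr ?exprn_gt0 ?addr_gt0// mul1r expr2.
  apply: (le_trans xN); rewrite -[leLHS]mulr1 ler_pM2l ?addr_gt0// lerDl ltW//.
have s20 : 0 <= sigma ^+ 2 by exact: sqr_ge0.
have h2 := ler_wpM2l s20 h1; have h3 := ler_wpM2l s20 CV1.
rewrite mulrCA; apply: (le_trans h2); apply: (le_trans h3).
rewrite (_ : 4 * (32 * CV) * sigma ^+ 2 = 4 * 32 * (sigma ^+ 2 * CV)); last by ring.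
apply: ler_peMl; first by apply: mulr_ge0 => //; exact: ltW.
by rewrite -natrM ler1n.
Qed.
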